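(* Let $b_n\equiv 0$ and let $(a_n)_{n\ge1}$ satisfy $0<a_n\le a_{n+1}\le 1$ for all $n$ and $a_n\to 1$. Let $d\mu(x)=w(x)\,dx$ be the measure associated with these Jacobi parameters. For any $x\in(-2,2)$, define $N(x)$ by $$2a_n\le|x|\ \text{ for } n\le N(x),\qquad 2a_n>|x|\ \text{ for } n>N(x),$$ and, for $n\le N(x)$, define $\gamma_n(x)\ge 0$ by $$\frac{|x|}{a_n}=2\cosh(\gamma_n(x)).$$ Then $w(x)=e^{-2Q(x)}$, where $$|Q(x)-g(x)|\le h(x),\qquad g(x)=\sum_{j=1}^{N(x)}\gamma_j(x),$$ and $h(x)$ is given by $$e^{h(x)}=C\,N(x)\,\bigl(a_{N(x)+2}-a_{N(x)+1}\bigr)^{-1}$$ for a constant $C$ not depending on $x$ (with $h(x)$ read as $+\infty$ if $a_{N(x)+2}=a_{N(x)+1}$).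
   Context: For bounded Jacobi parameters $\{a_n,b_n\}_{n\ge1}$ ($a_n>0$, $b_n\in\mathbb{R}$), the associated measure is the unique compactly supported probability measure $\mu$ on $\mathbb{R}$ whose orthonormal polynomials $p_n$ satisfy $xp_n=a_{n+1}p_{n+1}+b_{n+1}p_n+a_np_{n-1}$, $p_{-1}=0$, $p_0=1$. In the situation considered here the weight $w$ is symmetric and the measure is purely absolutely continuous, supported on $[-2,2]$ (no eigenvalues outside $[-2,2]$).
   Formalization: When N(x)=0 (|x|<2a_1) the stated formula gives e^{h}=0 and the bound fails if a_2>a_1; the factor N(x) is replaced by max(N(x),1), and w=e^{-2Q} is asserted for almost every x, as w is a density. *)

(* Defs.v *)
From HB Require Import structures.
From mathcomp Require Import all_boot all_order all_algebra.
From mathcomp Require Import all_classical all_reals all_analysis.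
Set Implicit Arguments.
Unset Strict Implicit.
Unset Printing Implicit Defensive.
Import Order.TTheory GRing.Theory Num.Theory.
Import numFieldNormedType.Exports.
Local Open Scope classical_set_scope.
Local Open Scope ring_scope.

Definition cosh (R : realType) (t : R) : R := (expR t + expR (- t)) / 2.

(* Sequences a, b are indexed from 1: the entry b 0 is never used, and a 0 only
   occurs multiplied by p_{-1} = 0. *)
Definition jacobi_recurrence (R : realType) (a b : nat -> R)
    (p : nat -> {poly R}) : Prop :=
  p 0%N = 1 /\
  forall n : nat,
    'X * p n = a n.+1 *: p n.+1 + b n.+1 *: p n
               + a n *: (if n is m.+1 then p m else 0).

Definition orthonormal_polys (R : realType)
    (mu : probability (measurableTypeR R) R) (p : nat -> {poly R}) : Prop :=
  (forall n : nat, size (p n) = n.+1 /\ 0 < lead_coef (p n)) /\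
  (forall m n : nat,
     (\int[mu]_x ((p m).[x] * (p n).[x])%:E)%E = ((m == n)%:R : R)%:E).

Definition compactly_supported (R : realType)
    (mu : probability (measurableTypeR R) R) : Prop :=
  exists2 K : set R, compact K & mu (~` K) = 0%E.

Definition jacobi_measure (R : realType) (a b : nat -> R)
    (mu : probability (measurableTypeR R) R) : Prop :=
  compactly_supported mu /\
  exists2 p : nat -> {poly R}, orthonormal_polys mu p & jacobi_recurrence a b p.

Definition has_density (R : realType)
    (mu : probability (measurableTypeR R) R) (w : R -> R) : Prop :=
  [/\ measurable_fun setT w,
      forall x : R, 0 <= w x &
      forall A : set R, measurable A ->
        mu A = (\int[lebesgue_measure]_(x in A) (w x)%:E)%E].

(* e^h = C N (a_{N+2} - a_{N+1})^{-1}, with h = +oo if a_{N+2} = a_{N+1}.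
   For N = 0, i.e. |x| < 2 a_1, the right-hand side vanishes and no finite h
   exists (h = -oo would make |Q - g| <= h false), so the factor N is read as 1
   there; for N >= 1 the formula is unchanged. *)
Definition error_bound (R : realType) (C : R) (a : nat -> R) (N : nat) : \bar R :=
  if a N.+2 == a N.+1 then +oo%E
  else (ln (C * (maxn N 1)%:R * (a N.+2 - a N.+1)^-1))%:E.

(* Main.v *)
Require Import Defs.
From HB Require Import structures.
From mathcomp Require Import all_boot all_order all_algebra.
From mathcomp Require Import all_classical all_reals all_analysis.
From mathcomp Require Import measurable_realfun ring lra.
Set Implicit Arguments.
Unset Strict Implicit.
Unset Printing Implicit Defensive.
Import Order.TTheory GRing.Theory Num.Theory.
Import numFieldNormedType.Exports.
Local Open Scope classical_set_scope.
Local Open Scope ring_scope.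

(** The Turan determinants [S_n = a_n^2 (p_n^2 + p_{n-1}^2) - x a_n p_n p_{n-1}]
    satisfy [S_{n+1} - S_n = (a_{n+1}^2 - a_n^2) p_n^2], so they increase with [n],
    while [S_n / (a_n^2 - x^2/4)] decreases as soon as [2 a_n > |x|].
    As [a_n -> 1], the measures [p_{n+i} p_{n+j} dmu] converge in moments to
    [cos ((i - j) t) dt / pi] with [x = 2 cos t], hence [S_n dmu] converges to
    [sqrt (1 - x^2/4) dx / pi].  Squeezing [S_n] between multiples of a fixed [S_m]
    then yields, for almost every [x] with [|x| < 2 a_m],
    [(a_m^2 - x^2/4) sqrt (1 - x^2/4) / pi <= S_m (1 - x^2/4) w] and
    [S_m w <= sqrt (1 - x^2/4) / pi].
    For [m = N(x) + 2] the determinant [S_m] is compared with [e^{2 g(x)}] by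
    running the recurrence through the hyperbolic range [n <= N(x)], where
    [p_n / p_{n-1} >= e^{gamma_n}] and [p_n = O(n) e^{gamma_1 + ... + gamma_n}];
    the factor [a_m^2 - x^2/4 >= 2 a_1 (a_{N+2} - a_{N+1})] gives the rest of [h]. *)

(** * Uniform polynomial approximation of tent functions on a segment *)

Section PolyApprox.
Context {R : realType}.
Implicit Types (f g : R -> R) (M : R) (q : {poly R}).

Definition poly_approx M f := forall e : R, 0 < e ->
  exists q, forall x, `|x| <= M -> `|f x - q.[x]| <= e.

(** The classical square-root iteration [p + (x^2 - p^2) / 2], whose values increase to
    [sqrt (x^2) = |x|] on [[-1, 1]]. *)
Fixpoint abs_poly (k : nat) : {poly R} :=
  if k is k'.+1 then abs_poly k' + 2^-1 *: ('X^2 - abs_poly k' ^+ 2) else 0.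

(** One iteration multiplies the error [y - p] (with [y = |x|]) by [1 - (y + p) / 2]. The third
    bound is the invariant that turns this contraction, which degenerates as [y] tends to 0, into a
    rate [2 / k] uniform in [x]. *)
Lemma abs_poly_bounds (k : nat) (x : R) : `|x| <= 1 ->
  [/\ 0 <= (abs_poly k).[x], (abs_poly k).[x] <= `|x| &
      (`|x| - (abs_poly k).[x]) * (1 + k%:R * `|x| / 2) <= `|x|].
Proof.
move=> x1; have x0 := normr_ge0 x.
elim: k => [|k [p0 px IH]]; first by rewrite /= horner0; split => //; lra.
rewrite [abs_poly _]/= !hornerE.
have -> : x ^+ 2 = `|x| ^+ 2 by rewrite real_normK ?num_real.
move: x0 x1 p0 px IH; set y := `|x|; set p := (abs_poly k).[x] => x0 x1 p0 px IH.
have k0 : 0 <= k%:R :> R by rewrite ler0n.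
rewrite -[k.+1%:R]natr1; 
have ypD : 0 <= (y - p) * (y + p) by rewrite mulr_ge0; lra.
have ypM : 0 <= (y - p) * (1 - (y + p) / 2) by rewrite mulr_ge0; lra.
split; [lra|lra|].
have -> : y - (p + 2^-1 * (y ^+ 2 - p ^+ 2)) = (y - p) * (1 - (y + p) / 2) by field.
have h1 : (1 - (y + p) / 2) * (1 + (k%:R + 1) * y / 2) <= 1 + k%:R * y / 2.
  have ky : 0 <= k%:R * y by rewrite mulr_ge0.
  have ky2 : 0 <= k%:R * y * y by rewrite mulr_ge0.
  have : 0 <= p * (1 + (k%:R + 1) * y / 2) by rewrite mulr_ge0//; lra.
  nra.
rewrite -mulrA; apply: le_trans IH; apply: ler_wpM2l => //; lra.
Qed.

Lemma abs_poly_error (k : nat) (x : R) : `|x| <= 1 ->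
  `| `|x| - (abs_poly k.+1).[x]| <= 2 / k.+1%:R.
Proof.
move=> x1; have [p0 px] := abs_poly_bounds k.+1 x1.
have : 0 < k.+1%:R :> R by rewrite ltr0n.
rewrite [`|_ - _|]ger0_norm ?subr_ge0//; have := normr_ge0 x.
move: p0 px; set y := `|x|; set p := (_).[x]; set K := k.+1%:R.
move=> p0 px y0 K0 H; rewrite ler_pdivlMr//.
change ((y - p) * K <= 2).
have [y_le0|y_gt0] := leP y 0.
  have -> : y - p = 0 by lra.
  by rewrite mul0r.
rewrite -(ler_pM2r y_gt0).
have -> : (y - p) * K * y = 2 * ((y - p) * (1 + K * y / 2) - (y - p)) by field.
by lra.
Qed.

Lemma poly_approx_horner M q : poly_approx M (horner q).
Proof. by move=> e e0; exists q => x _; rewrite subrr normr0 ltW. Qed.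

Lemma poly_approxD M f g :
  poly_approx M f -> poly_approx M g -> poly_approx M (fun x => f x + g x).
Proof.
move=> hf hg e e0; have e2 : 0 < e / 2 by lra.
have [p hp] := hf _ e2; have [q hq] := hg _ e2.
exists (p + q) => x xM; rewrite hornerD opprD addrACA.
by apply: le_trans (ler_normD _ _) _; have := hp _ xM; have := hq _ xM; lra.
Qed.

Lemma poly_approxMl M q f :
  poly_approx M f -> poly_approx M (fun x => q.[x] * f x).
Proof.
move=> hf e e0; have [b hb] := poly_disk_bound q M.
have b0 : 0 < `|b| + 1 by rewrite ltr_pwDr.
have [p hp] := hf (e / (`|b| + 1)) (divr_gt0 e0 b0).
exists (q * p) => x xM; rewrite hornerM -mulrBr normrM.
rewrite -[e](mulfVK (lt0r_neq0 b0)) mulrC ler_pM//; first exact: hp.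
by apply: le_trans (hb _ xM) _; rewrite (le_trans (ler_norm b))// lerDl.
Qed.

Lemma poly_approxN M f : poly_approx M f -> poly_approx M (fun x => - f x).
Proof.
move=> hf e e0; have [p hp] := hf e e0.
exists (- p) => x xM; rewrite hornerN -normrN.
by rewrite (_ : - (- f x - - p.[x]) = f x - p.[x]) ?hp//; ring.
Qed.

(** A polynomial [q] close to [f] is rescaled by a bound [B] into [[-1, 1]], composed with
    [abs_poly], and scaled back. *)
Lemma poly_approx_norm M f : poly_approx M f -> poly_approx M (fun x => `|f x|).
Proof.
move=> hf e e0; have e2 : 0 < e / 2 by lra.
have [q hq] := hf _ e2.
have [b hb] := poly_disk_bound q M.
set B := `|b| + 1; have B0 : 0 < B by rewrite ltr_pwDr.
have qB x : `|x| <= M -> `|q.[x] / B| <= 1.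
  move=> xM; rewrite normrM normfV (gtr0_norm B0) ler_pdivrMr// mul1r.
  by apply: le_trans (hb _ xM) _; rewrite (le_trans (ler_norm b))// lerDl.
(* This makes the rescaled error [B * (2 / k.+1)] at most [e / 2]. *)
pose k := Num.truncn (4 * B / e).
exists (B *: (abs_poly k.+1 \Po (B^-1 *: q))) => x xM.
rewrite hornerZ horner_comp hornerZ.
have h1 := hq _ xM; have h2 := abs_poly_error k (qB _ xM).
have h3 : `| `|q.[x]| - B * (abs_poly k.+1).[B^-1 * q.[x]]| <= e / 2.
  have -> : `|q.[x]| = B * `|q.[x] / B|.
    by rewrite normrM normfV (gtr0_norm B0) mulrC mulfVK ?gt_eqF.
  rewrite [B^-1 * _]mulrC -mulrBr normrM (gtr0_norm B0).
  apply: le_trans (ler_wpM2l (ltW B0) h2) _.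
  have k0 : 0 < k.+1%:R :> R by rewrite ltr0n.
  rewrite mulrA ler_pdivrMr//.
  have : 4 * B / e < k.+1%:R.
    exact: truncnS_gt.
  by rewrite ltr_pdivrMr//; lra.
have h4 := ler_dist_dist (f x) q.[x].
set u := `|f x| in h4 *; set v := `|q.[x]| in h3 h4; set w := B * _ in h3 *.
have -> : u - w = (u - v) + (v - w) by ring.
by apply: le_trans (ler_normD _ _) _; lra.
Qed.

(** The value [y] clamped to [[0, 1]], i.e. [min (max y 0) 1], written with absolute values so that
    [poly_approx_norm] applies. As [k] grows it tends to the indicator of the open ball of centre
    [c] and radius [r]. *)
Definition tent (k c r x : R) : R :=
  let y := k * (r - `|x - c|) in (`|y| + 1 - `|y - 1|) / 2.

Lemma tent_bounds k c r x : 0 <= tent k c r x <= 1.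
Proof.
rewrite /tent; set y := k * _.
have [|] := leP 0 y => h1; have [|] := leP 0 (y - 1) => h2;
  rewrite ?(ger0_norm h1) ?(ltr0_norm h1) ?(ger0_norm h2) ?(ltr0_norm h2);
  apply/andP; split; lra.
Qed.

Lemma tent_out k c r x : 0 <= k -> r <= `|x - c| -> tent k c r x = 0.
Proof.
move=> k0 h; rewrite /tent; set y := k * _.
have y0 : y <= 0 by rewrite /y mulr_ge0_le0//; lra.
by rewrite (ler0_norm y0) ler0_norm; lra.
Qed.

Lemma tent_in k c r x : 1 <= k * (r - `|x - c|) -> tent k c r x = 1.
Proof.
by rewrite /tent; set y := k * _ => y1; rewrite !ger0_norm; lra.
Qed.

Lemma poly_approx_tent M k c r : poly_approx M (tent k c r).
Proof.
pose y (x : R) := k%:P.[x] * (r%:P.[x] + - `|('X - c%:P).[x]|).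
have hy : poly_approx M y.
  apply: poly_approxMl; apply: poly_approxD; first exact: poly_approx_horner.
  by apply: poly_approxN; apply: poly_approx_norm; exact: poly_approx_horner.
have -> : tent k c r =
    (fun x => (2^-1)%:P.[x] * ((`|y x| + 1%:P.[x]) + - `|y x + (-1)%:P.[x]|)).
  apply/funext => x; rewrite /tent /y !hornerE.
  by rewrite [(_ + 1 - _) / 2]mulrC.
apply: poly_approxMl; apply: poly_approxD.
  by apply: poly_approxD; [exact: poly_approx_norm|exact: poly_approx_horner].
apply: poly_approxN; apply: poly_approx_norm.
by apply: poly_approxD => //; exact: poly_approx_horner.
Qed.

Lemma continuous_tent k c r : continuous (tent k c r).
Proof.
move=> x; have hy : {for x, continuous (fun x => k * (r - `|x - c|))}.
  apply: cvgM; first exact: cvg_cst.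
  apply: cvgB; first exact: cvg_cst.
  by apply: (@cvg_norm _ _ _ _ _ (fun x : R => x - c));
     apply: cvgB; [exact: cvg_id|exact: cvg_cst].
apply: cvgM; last exact: cvg_cst.
apply: cvgB; last first.
  apply: cvg_norm; apply: cvgB; last exact: cvg_cst. exact: hy.
apply: cvgD; last exact: cvg_cst.
by apply: cvg_norm; exact: hy.
Qed.

End PolyApprox.

(** * Cosine moments of the arcsine law and the semicircle weight *)

Section ArcsineMoments.
Context {R : realType}.
Local Notation leb := (@lebesgue_measure R).
Implicit Types (f : R -> R) (q : {poly R}) (r : R).

Lemma itv_integrable f (b c : R) : continuous f ->
  leb.-integrable `[b, c] (EFin \o f).
Proof.
move=> cf; apply: continuous_compact_integrable; first exact: segment_compact.
exact: continuous_subspaceT.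
Qed.

(* The integral of [pi q(x) T_r(x/2)] against the arcsine law of [-2, 2]. *)
Definition arc_moment q r :=
  \int[leb]_(t in `[0, pi]) (q.[2 * cos t] * cos (r * t)).

Lemma continuous_scaled_cos r : continuous (fun t : R => cos (r * t)).
Proof.
move=> t; apply: (@continuous_comp _ _ _ (fun t => r * t) (@cos R)).
  by apply: mulrl_continuous.
exact: continuous_cos.
Qed.

Lemma continuous_poly_cos q : continuous (fun t : R => q.[2 * cos t]).
Proof.
move=> t; apply: (@continuous_comp _ _ _ (fun t : R => 2 * cos t) (horner q)).
  by apply: cvgM; [exact: cvg_cst|exact: continuous_cos].
exact: continuous_horner.
Qed.

Lemma continuous_arc q r : continuous (fun t : R => q.[2 * cos t] * cos (r * t)).
Proof.
by move=> t; apply: cvgM; [exact: continuous_poly_cos|exact: continuous_scaled_cos].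
Qed.

Lemma arc_moment0 r : arc_moment 0 r = 0.
Proof.
rewrite /arc_moment (@eq_Rintegral _ _ _ _ _ (cst 0)).
  by rewrite Rintegral_cst// mul0r.
by move=> t _; rewrite horner0 mul0r.
Qed.

(** This is [2 cos t cos (r t) = cos ((r - 1) t) + cos ((r + 1) t)], the counterpart of the Jacobi
    recurrence with all [a_n = 1]. *)
Lemma arc_momentXD q (c r : R) : arc_moment (q * 'X + c%:P) r =
  arc_moment q (r - 1) + arc_moment q (r + 1) + c * arc_moment 1 r.
Proof.
have mD : measurable (`[0, pi]%classic : set (measurableTypeR R)) by exact: measurable_itv.
have iA q' r' := itv_integrable 0 pi (@continuous_arc q' r').
rewrite /arc_moment -RintegralZl; [|exact: mD|exact: iA].
rewrite -RintegralD; [|exact: mD|exact: iA|exact: iA].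
rewrite -RintegralD; [|exact: mD| |]; last 2 first.
  apply: itv_integrable => t; apply: cvgD; exact: continuous_arc.
  apply: itv_integrable => t; apply: cvgM; [exact: cvg_cst|exact: continuous_arc].
apply: eq_Rintegral => t _; rewrite hornerMXaddC hornerC.
rewrite [(r - 1) * t]mulrBl [(r + 1) * t]mulrDl mul1r cosB cosD.
by ring.
Qed.

(** Off the diagonal, the antiderivative [sin (r t) / r] vanishes at both [0] and [pi] because [r]
    is a nonzero integer. *)
Lemma arc_moment1 (i j : nat) :
  arc_moment 1 (i%:R - j%:R) = pi * (i == j)%:R.
Proof.
rewrite /arc_moment; have [->|ij] := eqVneq i j.
  rewrite (@eq_Rintegral _ _ _ _ _ (cst 1)).
    rewrite Rintegral_cst//= mul1r mulr1 lebesgue_measure_itv/= lte_fin pi_gt0.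
    by rewrite -EFinD subr0.
  by move=> t _; rewrite hornerC mul1r subrr mul0r cos0.
set r := i%:R - j%:R.
have r0 : r != 0 by rewrite subr_eq0 eqr_nat.
rewrite mulr0 /Rintegral (@continuous_FTC2 _ _ (fun t => r^-1 * sin (r * t))).
- rewrite mulr0 sin0 mulr0 -EFinB subr0 /=.
  suff -> : sin (r * pi) = 0 by rewrite mulr0.
  have sinn (n : nat) : sin (n%:R * pi) = 0 :> R.
    elim: n => [|n IH]; first by rewrite mul0r sin0.
    by rewrite -natr1 mulrDl mul1r sinD IH sinpi mul0r mulr0 addr0.
  by rewrite /r mulrBl sinB !sinn mul0r mulr0 subrr.
- exact: pi_gt0.
- by apply: continuous_subspaceT => t; exact: continuous_arc.
- have ct : continuous (fun t : R => r^-1 * sin (r * t)).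
    move=> t; apply: cvgM; first exact: cvg_cst.
    apply: (@continuous_comp _ _ _ (fun t => r * t) (@sin R)).
      by apply: mulrl_continuous.
    exact: continuous_sin.
  split=> [t _| |].
  + by apply: ex_derive.
  + by apply: cvg_at_right_filter; exact: ct.
  + by apply: cvg_at_left_filter; exact: ct.
- move=> t _; rewrite derive1E derive_val hornerC mul1r /GRing.scale/=.
  by field.
Qed.

(** Here [1 - cos (2 t) = 2 sin^2 t], and the decreasing substitution [x = 2 cos t] turns one factor
    [sin t] into [sqrt (1 - x^2 / 4)] and the other, with the 2, into the Jacobian. *)
Lemma arc_moment_semicircle q :
  arc_moment q 0 - arc_moment q 2 =
  \int[leb]_(x in `[(-2), 2]) (q.[x] * Num.sqrt (1 - x ^+ 2 / 4)).
Proof.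
have mD : measurable (`[0, pi]%classic : set (measurableTypeR R)) by exact: measurable_itv.
have iA q' r' := itv_integrable 0 pi (@continuous_arc q' r').
rewrite /arc_moment -RintegralB; [|exact: mD|exact: iA|exact: iA].
pose F (t : R) : R := 2 * cos t.
pose G (x : R) := q.[x] * Num.sqrt (1 - x ^+ 2 / 4).
have dF (t : R) : is_derive t (1 : R) F (- (2 * sin t)).
  apply: is_derive_eq. by rewrite /GRing.scale/= mulrN.
have F'E : derive1 F = (fun t => - (2 * sin t)).
  by apply/funext => t; rewrite derive1E derive_val.
have cF' : continuous (derive1 F).
  rewrite F'E => t; apply: cvgN; apply: cvgM; first exact: cvg_cst.
  exact: continuous_sin.
have cF : continuous F.
  by move=> t; apply: cvgM; [exact: cvg_cst|exact: continuous_cos].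
have cG : continuous G.
  move=> x; apply: cvgM; first exact: continuous_horner.
  apply: (@continuous_comp _ _ _ (fun x : R => 1 - x ^+ 2 / 4) (@Num.sqrt R)).
    apply: cvgB; first exact: cvg_cst.
    by apply: cvgM; [exact: exprn_continuous|exact: cvg_cst].
  exact: sqrt_continuous.
have F0 : F 0 = 2 by rewrite /F cos0 mulr1.
have Fpi : F pi = -2 by rewrite /F cospi mulrN1.
have := @integration_by_substitution_decreasing R F G 0 pi.
rewrite F0 Fpi => H.
rewrite [RHS]/Rintegral H.
- congr fine; apply: eq_integral => t; rewrite inE/= in_itv/= => /andP[t0 tpi].
  congr EFin; rewrite F'E.
  change (q.[2 * cos t] * cos (0 * t) - q.[2 * cos t] * cos (2 * t) =
    q.[2 * cos t] * Num.sqrt (1 - (2 * cos t) ^+ 2 / 4) * - - (2 * sin t)).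
  have -> : 1 - (2 * cos t) ^+ 2 / 4 = sin t ^+ 2.
    by rewrite sin2cos2; field.
  rewrite sqrtr_sqr ger0_norm; last by apply: sin_ge0_pi; rewrite t0 tpi.
  rewrite mul0r cos0 (_ : 2 * t = t *+ 2); last by rewrite mulr_natl.
  rewrite cos_mulr2n cos2sin2.
  by ring.
- exact: pi_ge0.
- move=> x y x0 y0 xy; rewrite /F ltr_pM2l// ltr_cos//.
- by move=> t _; exact: cF'.
- by apply/cvg_ex; exists (derive1 F 0); apply: cvg_at_right_filter; exact: cF'.
- by apply/cvg_ex; exists (derive1 F pi); apply: cvg_at_left_filter; exact: cF'.
- split=> [t _| |].
  + exact: ex_derive.
  + by apply: cvg_at_right_filter; exact: cF.
  + by apply: cvg_at_left_filter; exact: cF.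
- by apply: continuous_subspaceT; exact: cG.
Qed.

End ArcsineMoments.

(** * Monotonicity of Turan determinants at a fixed [x] *)

Section JacobiSolutions.
Context {R : realType}.
Variables (a : nat -> R) (x : R) (u : nat -> R).
Hypothesis a_gt0 : forall n, 0 < a n.+1.
Hypothesis a_nd : forall n, a n.+1 <= a n.+2.
Hypothesis a_le1 : forall n, a n.+1 <= 1.
Hypothesis u_rec : forall n, x * u n.+1 = a n.+2 * u n.+2 + a n.+1 * u n.

(* Indices are shifted by one to avoid [n = 0]: this is [S_{n+1}]. *)
Definition turan n :=
  a n.+1 ^+ 2 * (u n.+1 ^+ 2 + u n ^+ 2) - x * a n.+1 * u n.+1 * u n.

(** The difference of the two sides factors through the defect of the recurrence, which is zero. *)
Lemma turanS n :
  turan n.+1 = turan n + (a n.+2 ^+ 2 - a n.+1 ^+ 2) * u n.+1 ^+ 2.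
Proof.
rewrite /turan; apply/eqP; rewrite -subr_eq0; apply/eqP.
have -> : a n.+2 ^+ 2 * (u n.+2 ^+ 2 + u n.+1 ^+ 2) - x * a n.+2 * u n.+2 * u n.+1
  - (a n.+1 ^+ 2 * (u n.+1 ^+ 2 + u n ^+ 2) - x * a n.+1 * u n.+1 * u n
     + (a n.+2 ^+ 2 - a n.+1 ^+ 2) * u n.+1 ^+ 2)
  = (a n.+2 * u n.+2 - a n.+1 * u n) *
    (a n.+2 * u n.+2 + a n.+1 * u n - x * u n.+1) by ring.
by rewrite -u_rec subrr mulr0.
Qed.

(** Completing the square in [u n.+1]. The form is symmetric in [u n] and [u n.+1], so [turan_geS]
    follows in the same way. *)
Lemma turan_ge n : (a n.+1 ^+ 2 - x ^+ 2 / 4) * u n ^+ 2 <= turan n.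
Proof.
rewrite -subr_ge0.
have -> : turan n - (a n.+1 ^+ 2 - x ^+ 2 / 4) * u n ^+ 2 =
  (a n.+1 * u n.+1 - x / 2 * u n) ^+ 2 by rewrite /turan; field.
exact: sqr_ge0.
Qed.

Lemma turan_geS n : (a n.+1 ^+ 2 - x ^+ 2 / 4) * u n.+1 ^+ 2 <= turan n.
Proof.
rewrite -subr_ge0.
have -> : turan n - (a n.+1 ^+ 2 - x ^+ 2 / 4) * u n.+1 ^+ 2 =
  (a n.+1 * u n - x / 2 * u n.+1) ^+ 2 by rewrite /turan; field.
exact: sqr_ge0.
Qed.

Lemma a_sqr_nd n : a n.+1 ^+ 2 <= a n.+2 ^+ 2.
Proof. by rewrite lerXn2r// ?nnegrE ltW. Qed.

Lemma turan_nd n k : turan n <= turan (n + k).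
Proof.
elim: k => [|k IH]; first by rewrite addn0.
rewrite addnS turanS; apply: le_trans IH _.
by rewrite lerDl mulr_ge0 ?sqr_ge0// subr_ge0 a_sqr_nd.
Qed.

(* Induction on [k] shows that [turan n / (a n.+1 ^+ 2 - x ^+ 2 / 4)] decreases. *)
Lemma turan_ratio n k : 0 <= a n.+1 ^+ 2 - x ^+ 2 / 4 ->
  (a n.+1 ^+ 2 - x ^+ 2 / 4) * turan (n + k) <= (1 - x ^+ 2 / 4) * turan n.
Proof.
move=> an0.
have mono j : a n.+1 ^+ 2 <= a (n + j).+1 ^+ 2.
  elim: j => [|j IH]; first by rewrite addn0.
  by apply: le_trans IH _; rewrite addnS a_sqr_nd.
have T0 j : 0 <= turan (n + j).
  apply: le_trans (turan_ge _); rewrite mulr_ge0 ?sqr_ge0//.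
  by have := mono j; lra.
suff H : (a n.+1 ^+ 2 - x ^+ 2 / 4) * turan (n + k) <=
         (a (n + k).+1 ^+ 2 - x ^+ 2 / 4) * turan n.
  apply: le_trans H _; apply: ler_wpM2r.
    by have := T0 0%N; rewrite addn0.
  have : a (n + k).+1 ^+ 2 <= 1 by rewrite expr_le1// ltW.
  by lra.
elim: k => [|k IH]; first by rewrite addn0.
rewrite addnS turanS.
set A := a n.+1 ^+ 2 - x ^+ 2 / 4 in an0 IH *.
set B := a (n + k).+1 ^+ 2 in IH *; set B' := a (n + k).+2 ^+ 2.
set T := turan (n + k) in IH *; set T1 := turan n in IH *.
set v := u _ ^+ 2.
have hv : (B - x ^+ 2 / 4) * v <= T by exact: turan_geS.
have BB : 0 <= B' - B by rewrite subr_ge0 a_sqr_nd.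
have AB : A <= B - x ^+ 2 / 4 by rewrite lerD2r mono.
(* In the degenerate case [0 <= A <= B - x ^+ 2 / 4 <= 0] forces [A = 0]. Otherwise both sides are
   multiplied by [B - x ^+ 2 / 4]: then [hv] absorbs the increment of the determinant, leaving
   [A * T * (B' - x ^+ 2 / 4)], to which [IH] applies. *)
have [B0|B0] := leP (B - x ^+ 2 / 4) 0.
  have A0 : A = 0 by lra.
  rewrite A0 mul0r mulr_ge0//; first by lra.
  by have := T0 0%N; rewrite addn0.
rewrite -(ler_pM2r B0).
apply: (@le_trans _ _ (A * T * (B' - x ^+ 2 / 4))).
  have := ler_wpM2l (mulr_ge0 an0 BB) hv; lra.
have B'0 : 0 <= B' - x ^+ 2 / 4 by lra.
have := ler_wpM2r B'0 IH; lra.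
Qed.

End JacobiSolutions.

(** * Growth of the solution in the hyperbolic range, with [lam n] in the role of [e^{gamma_n}] *)

Section Growth.
Context {R : realType}.
Variables (a : nat -> R) (x : R) (u : nat -> R) (lam : nat -> R) (N : nat).
Hypothesis a_gt0 : forall n, 0 < a n.+1.
Hypothesis a_nd : forall n, a n.+1 <= a n.+2.
Hypothesis x_ge0 : 0 <= x.
Hypothesis u_rec : forall n, x * u n.+1 = a n.+2 * u n.+2 + a n.+1 * u n.
Hypothesis u0 : u 0%N = 1.
Hypothesis u1 : x = a 1%N * u 1%N.
Hypothesis lam_ge1 : forall n, (n < N)%N -> 1 <= lam n.+1.
Hypothesis lamE : forall n, (n < N)%N -> x = a n.+1 * (lam n.+1 + (lam n.+1)^-1).

(** The function [l + 1 / l] increases on [l >= 1], and its value [x / a_n] at [lam n] does not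
    increase with [n]. *)
Lemma lam_ni n : (n.+1 < N)%N -> lam n.+2 <= lam n.+1.
Proof.
move=> nN; have nN' := ltnW nN.
have l1 := lam_ge1 nN; have l2 := lam_ge1 nN'.
have := lamE nN; rewrite {1}(lamE nN').
rewrite leNgt => E; apply/negP => lt12.
have : a n.+1 * (lam n.+1 + (lam n.+1)^-1) < a n.+2 * (lam n.+2 + (lam n.+2)^-1).
  apply: (@lt_le_trans _ _ (a n.+1 * (lam n.+2 + (lam n.+2)^-1))); last first.
    rewrite ler_wpM2r// addr_ge0// ?invr_ge0; lra.
  rewrite ltr_pM2l// -subr_gt0.
  have -> : lam n.+2 + (lam n.+2)^-1 - (lam n.+1 + (lam n.+1)^-1) =
    (lam n.+2 - lam n.+1) * (1 - (lam n.+1)^-1 * (lam n.+2)^-1).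
    by field; apply/andP; split; lra.
  rewrite mulr_gt0 ?subr_gt0// -invfM invf_lt1; first by nra.
  by rewrite mulr_gt0; lra.
by rewrite E ltxx.
Qed.

(** The ratio bound propagates: since [a] increases and [lam] decreases, the hypothesis at [n]
    bounds [a n.+1 * u n] by [a n.+2 / lam n.+2 * u n.+1], and [x - a n.+2 / lam n.+2 = a n.+2 * lam
    n.+2]. *)
Lemma growth_step n : (n < N)%N -> 0 < u n /\ lam n.+1 * u n <= u n.+1.
Proof.
elim: n => [|n IH] nN.
  rewrite u0 mulr1; split=> //.
  have := lamE nN; rewrite {1}u1 => /(mulfI (lt0r_neq0 (a_gt0 0)))->.
  by rewrite lerDl invr_ge0 (le_trans ler01) ?lam_ge1.
have [un0 IHn] := IH (ltnW nN).
have l1 := lam_ge1 nN; have l2 := lam_ge1 (ltnW nN).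
have uS0 : 0 < u n.+1 by apply: lt_le_trans IHn; rewrite mulr_gt0//; lra.
split => //.
rewrite -(ler_pM2l (a_gt0 n.+1)).
have -> : a n.+2 * u n.+2 = x * u n.+1 - a n.+1 * u n by rewrite u_rec addrK.
rewrite {1}(lamE nN).
set l := lam n.+2 in l1 *.
suff h : a n.+1 * u n <= a n.+2 * (l^-1 * u n.+1) by lra.
apply: ler_pM; [exact: ltW|exact: ltW|exact: a_nd|].
have l0 : 0 < l by lra.
rewrite mulrC ler_pdivlMr// mulrC; apply: le_trans IHn.
by rewrite ler_wpM2r ?(ltW un0)// lam_ni.
Qed.

Lemma growth_lower n : (n <= N)%N -> \prod_(1 <= j < n.+1) lam j <= u n.
Proof.
elim: n => [|n IH] nN; first by rewrite big_geq// u0.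
rewrite big_nat_recr//= mulrC; have [un0 h] := growth_step nN.
apply: le_trans h; rewrite ler_wpM2l ?IH// ?(ltnW nN)//.
by apply: le_trans (lam_ge1 nN).
Qed.

(* With [b_n = a_n / lam_n], which increases, [a_n u_n - b_n u_{n-1}] grows at
   most by the factor [lam_n] at each step. *)
Lemma growth_increment n : (n < N)%N ->
  a n.+1 * u n.+1 - a n.+1 / lam n.+1 * u n <= x * \prod_(1 <= j < n.+1) lam j.
Proof.
elim: n => [|n IH] nN.
  rewrite big_geq// -u1 u0 !mulr1 gerBl divr_ge0 ?ltW//.
  by apply: lt_le_trans (lam_ge1 nN).
have nN' := ltnW nN; have {}IH := IH nN'.
have l1 := lam_ge1 nN; have l2 := lam_ge1 nN'.
have [un0 _] := growth_step nN'; have [uS0 _] := growth_step nN.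
rewrite big_nat_recr//=.
have l20 : 0 < lam n.+1 by lra.
have l10 : 0 < lam n.+2 by lra.
apply: (@le_trans _ _ (lam n.+1 * (a n.+1 * u n.+1 - a n.+1 / lam n.+1 * u n))); last first.
  by rewrite mulrA [x * _ * _]mulrC ler_wpM2l// ltW.
have -> : a n.+2 * u n.+2 = x * u n.+1 - a n.+1 * u n by rewrite u_rec addrK.
have -> : lam n.+1 * (a n.+1 * u n.+1 - a n.+1 / lam n.+1 * u n) =
  a n.+1 * lam n.+1 * u n.+1 - a n.+1 * u n by field; lra.
suff h : (x - a n.+2 / lam n.+2) * u n.+1 <= a n.+1 * lam n.+1 * u n.+1 by lra.
rewrite ler_wpM2r ?(ltW uS0)//.
have h1 : a n.+1 / lam n.+1 <= a n.+2 / lam n.+2.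
  apply: ler_pM; [exact: ltW|by rewrite invr_ge0 ltW|exact: a_nd|].
  by rewrite lef_pV2 ?posrE// lam_ni.
by have := lamE nN'; lra.
Qed.

(** By [growth_increment], each step adds at most [x / a 1] to the factor in front of the product,
    whence its linear growth in [n]. *)
Lemma growth_upper n : (n <= N)%N ->
  u n <= (1 + n%:R * (x / a 1%N)) * \prod_(1 <= j < n.+1) lam j.
Proof.
have a1 m : a 1%N <= a m.+1.
  by elim: m => // m IH; exact: le_trans IH (a_nd m).
elim: n => [|n IH] nN; first by rewrite big_geq// u0 mul0r addr0 mulr1.
have {}IH := IH (ltnW nN).
have h := growth_increment nN; have l1 := lam_ge1 nN.
have [un0 _] := growth_step nN.
rewrite big_nat_recr//=; set P := \prod_(1 <= j < n.+1) lam j in IH h *.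
have P0 : 1 <= P.
  rewrite /P big_nat; elim/big_ind: _ => // [y z y1 z1|j /andP[j1 jn]].
    by rewrite -[1]mulr1 ler_pM.
  by case: j j1 jn => // j _ jn; rewrite lam_ge1// (leq_trans _ nN)// ltnS ltnW.
have l0 : 0 < lam n.+1 by lra.
have h2 : u n.+1 <= u n / lam n.+1 + x / a n.+1 * P.
  rewrite -(ler_pM2l (a_gt0 n)).
  have -> : a n.+1 * (u n / lam n.+1 + x / a n.+1 * P) =
    a n.+1 / lam n.+1 * u n + x * P.
    by field; rewrite !gt_eqF.
  by lra.
apply: le_trans h2 _.
have h3 : u n / lam n.+1 <= u n.
  by rewrite ler_pdivrMr// ler_peMr// ltW.
have h4 : x / a n.+1 * P <= x / a 1%N * P.
  rewrite ler_wpM2r; [by []|lra|].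
  by rewrite ler_wpM2l// lef_pV2 ?posrE.
rewrite -natr1; set c := x / a 1%N in IH h4 *.
have c0 : 0 <= c by rewrite divr_ge0// ltW.
have n0 : 0 <= n%:R :> R by rewrite ler0n.
have nc0 : 0 <= n%:R * c by rewrite mulr_ge0.
have Z0 : 0 <= (1 + (n%:R + 1) * c) * P by rewrite mulr_ge0; lra.
have : (1 + (n%:R + 1) * c) * P <= (1 + (n%:R + 1) * c) * P * lam n.+1 by rewrite ler_peMr.
lra.
Qed.

End Growth.

(** * Convergence of the Turan determinants, as densities against [mu], to the semicircle law *)

Section TuranLimit.
Context {R : realType}.
Variable mu : probability (measurableTypeR R) R.
Variable M : R.
Hypothesis mu_supp : mu (~` `[- M, M]) = 0%E.
Variables (a : nat -> R) (p : nat -> {poly R}).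
Hypothesis a_ge0 : forall n, 0 <= a n.+1.
Hypothesis a_le1 : forall n, a n.+1 <= 1.
Hypothesis a_cvg : a @ \oo --> (1 : R).
Hypothesis p_orth : forall m n,
  (\int[mu]_x ((p m).[x] * (p n).[x])%:E)%E = ((m == n)%:R : R)%:E.
Hypothesis p_rec : forall n, 'X * p n.+1 = a n.+2 *: p n.+2 + a n.+1 *: p n.

Local Notation leb := (@lebesgue_measure R).
Local Notation D := (`[- M, M]%classic : set (measurableTypeR R)).
Implicit Types (f g : R -> R) (q : {poly R}).

Let mD : measurable D. Proof. exact: measurable_itv. Qed.

Lemma supp_integrable f : continuous f -> mu.-integrable D (EFin \o f).
Proof.
move=> cf; apply: measurable_bounded_integrable => //.
- by rewrite (le_lt_trans (probability_le1 mu mD))// ltry.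
- by apply: measurable_funTS; exact: continuous_measurable_fun.
- have /compact_bounded[B [_ mrt]] : compact (f @` (`[- M, M] : set R)).
    by apply: continuous_compact; [exact: continuous_subspaceT|exact: segment_compact].
  by exists B; split; rewrite ?num_real // => ? ? ? ?; exact: mrt.
Qed.

(** Integration over the segment [D], which carries all of [mu], makes every continuous integrand
    bounded and hence integrable. *)
Definition poly_mean q := \int[mu]_(x in D) q.[x].

Let poly_mean_int q : mu.-integrable D (EFin \o horner q).
Proof. by apply: supp_integrable; exact: continuous_horner. Qed.

Lemma poly_meanD q1 q2 : poly_mean (q1 + q2) = poly_mean q1 + poly_mean q2.
Proof.
rewrite /poly_mean -RintegralD//; apply: eq_Rintegral => x _; exact: hornerD.
Qed.

Lemma poly_meanZ c q : poly_mean (c *: q) = c * poly_mean q.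
Proof.
rewrite /poly_mean -RintegralZl//; apply: eq_Rintegral => x _; exact: hornerZ.
Qed.

Lemma poly_meanB q1 q2 : poly_mean (q1 - q2) = poly_mean q1 - poly_mean q2.
Proof. by rewrite -scaleN1r poly_meanD poly_meanZ mulN1r. Qed.

Lemma poly_mean_orth m n : poly_mean (p m * p n) = (m == n)%:R.
Proof.
have mN : measurable (~` D) by exact: measurableC.
have iT : mu.-integrable setT (EFin \o horner (p m * p n)).
  have mf : measurable_fun setT (EFin \o horner (p m * p n)).
    by apply/measurable_EFinP; exact: measurable_poly.
  by apply/(negligible_integrable mN measurableT mf mu_supp); rewrite setTD setCK.
have := negligible_integral mN measurableT iT mu_supp.
rewrite setTD setCK /poly_mean /Rintegral => <-.
by under eq_integral do rewrite /= hornerM; rewrite p_orth.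
Qed.

(** Induction on [q] in Horner form. A factor ['X] is moved onto [p (n + i)] by the recurrence,
    which shifts [i] by one either way; with [a_n -> 1] the limit obeys [arc_momentXD]. Constants
    are settled by orthonormality. *)
Lemma moment_cvg q (i j : nat) :
  poly_mean (q * p (n + i) * p (n + j)) @[n --> \oo] -->
    pi^-1 * arc_moment q (i%:R - j%:R).
Proof.
elim/poly_ind: q i j => [|q c IH] i j.
  rewrite arc_moment0 mulr0.
  rewrite [X in X @ _](_ : _ = cst 0); first exact: cvg_cst.
  by apply/funext => n; rewrite !mul0r -[0 in LHS](scale0r 1) poly_meanZ mul0r.
(* Passing to [n.+1] keeps the index of [p (n.+1 + i)] positive, as [p_rec] requires. *)
rewrite -cvg_shiftS /=.
rewrite [X in X @ _](_ : _ = (fun n =>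
    a (n + i.+2)%N * poly_mean (q * p (n + i.+2)%N * p (n + j.+1)%N) +
    a (n + i.+1)%N * poly_mean (q * p (n + i)%N * p (n + j.+1)%N) +
    c * (i == j)%:R)); last first.
  apply/funext => n.
  have -> : (q * 'X + c%:P) * p (n.+1 + i)%N * p (n.+1 + j)%N =
     a (n + i.+2)%N *: (q * p (n + i.+2)%N * p (n + j.+1)%N) +
     a (n + i.+1)%N *: (q * p (n + i)%N * p (n + j.+1)%N) +
     c *: (p (n.+1 + i)%N * p (n.+1 + j)%N).
    rewrite !addSn !addnS.
    transitivity (q * ('X * p (n + i).+1) * p (n + j).+1 +
      c *: (p (n + i).+1 * p (n + j).+1)); first by rewrite -mul_polyC; ring.
    by rewrite p_rec -!mul_polyC; ring.
  by rewrite !poly_meanD !poly_meanZ poly_mean_orth eqn_add2l.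
rewrite arc_momentXD arc_moment1 !mulrDr.
have acv k : a (n + k)%N @[n --> \oo] --> (1 : R) by rewrite cvg_shiftn.
apply: cvgD.
  rewrite addrC; apply: cvgD.
    rewrite -[X in _ --> X]mul1r; apply: cvgM; first exact: acv.
    have -> : i%:R - j%:R + 1 = i.+2%:R - j.+1%:R :> R by rewrite -!natr1; ring.
    exact: IH.
  rewrite -[X in _ --> X]mul1r; apply: cvgM; first exact: acv.
  have -> : i%:R - j%:R - 1 = i%:R - j.+1%:R :> R by rewrite -!natr1; ring.
  exact: IH.
rewrite [X in _ --> X](_ : _ = c * (i == j)%:R); first exact: cvg_cst.
by rewrite mulrCA mulKf// gt_eqF// pi_gt0.
Qed.

Definition turan_poly n : {poly R} :=
  a n.+1 ^+ 2 *: (p n.+1 ^+ 2 + p n ^+ 2) - a n.+1 *: ('X * p n.+1 * p n).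

Lemma turan_polyE n x :
  (turan_poly n).[x] = turan a x (fun n => (p n).[x]) n.
Proof.
rewrite /turan_poly /turan hornerD hornerN !hornerZ hornerD !expr2 !hornerM hornerX.
by ring.
Qed.

(** The expectation of [f] under the semicircle law of [[-2, 2]], whose density is
    [sqrt (4 - x^2) / (2 pi)]. *)
Definition semicircle f :=
  pi^-1 * \int[leb]_(x in `[(-2), 2]) (f x * Num.sqrt (1 - x ^+ 2 / 4)).

(** The two squares contribute [2 * arc_moment q 0] and the cross term removes
    [arc_moment q 0 + arc_moment q 2]; what remains is the semicircle integral. *)
Lemma turan_cvg q :
  poly_mean (q * turan_poly n) @[n --> \oo] --> semicircle (horner q).
Proof.
rewrite /semicircle -arc_moment_semicircle.
rewrite [X in X @ _](_ : _ = (fun n =>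
    a (n + 1)%N * a (n + 1)%N * (poly_mean (q * p (n + 1)%N * p (n + 1)%N) +
      poly_mean (q * p (n + 0)%N * p (n + 0)%N)) -
    a (n + 1)%N * poly_mean ((q * 'X + 0%:P) * p (n + 1)%N * p (n + 0)%N))); last first.
  apply/funext => n; rewrite addn1 addn0 -poly_meanD -!poly_meanZ -poly_meanB; congr poly_mean.
  by rewrite /turan_poly -!mul_polyC polyCM; ring.
have acv : a (n + 1)%N @[n --> \oo] --> (1 : R) by rewrite cvg_shiftn.
have -> : pi^-1 * (arc_moment q 0 - arc_moment q 2) =
   1 * 1 * (pi^-1 * arc_moment q (1%:R - 1%:R) + pi^-1 * arc_moment q (0%:R - 0%:R))
   - 1 * (pi^-1 * arc_moment (q * 'X + 0%:P) (1%:R - 0%:R)).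
  rewrite arc_momentXD !subrr !subr0 subrr mul0r addr0 !mul1r.
  by ring.
apply: cvgB; (apply: cvgM; first by [exact: acv|apply: cvgM; exact: acv]).
  by apply: cvgD; exact: moment_cvg.
exact: moment_cvg.
Qed.

Let sqrt_int f : continuous f ->
  leb.-integrable `[(-2), 2] (EFin \o (fun x => f x * Num.sqrt (1 - x ^+ 2 / 4))).
Proof.
move=> cf; apply: itv_integrable => x; apply: cvgM; first exact: cf.
apply: (@continuous_comp _ _ _ (fun x : R => 1 - x ^+ 2 / 4) (@Num.sqrt R)).
  apply: cvgB; first exact: cvg_cst.
  by apply: cvgM; [exact: exprn_continuous|exact: cvg_cst].
exact: sqrt_continuous.
Qed.

(** Since [p n.+1 ^+ 2 + p n ^+ 2] has mean 2, this bounds the total variation of [turan_poly n]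
    against [mu] uniformly in [n]. *)
Lemma turan_norm_le n x : `|x| <= M ->
  `|(turan_poly n).[x]| <= (1 + M) * ((p n.+1 ^+ 2).[x] + (p n ^+ 2).[x]).
Proof.
move=> xM; have M0 := le_trans (normr_ge0 x) xM.
rewrite turan_polyE /turan !horner_exp; set u := (p n.+1).[x]; set v := (p n).[x].
have a0 := a_ge0 n; have a1 := a_le1 n.
have a21 : a n.+1 ^+ 2 <= 1 by rewrite expr_le1.
have uv0 : 0 <= u ^+ 2 + v ^+ 2 by rewrite addr_ge0 ?sqr_ge0.
have huv : `|u * v| <= u ^+ 2 + v ^+ 2.
  rewrite ler_norml; have := sqr_ge0 (u - v); have := sqr_ge0 (u + v).
  have := sqr_ge0 u; have := sqr_ge0 v.
  by move=> *; apply/andP; split; lra.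
apply: le_trans (ler_normB _ _) _; rewrite mulrDl lerD//.
  by rewrite normrM !ger0_norm ?sqr_ge0// ler_wpM2r.
rewrite -mulrA normrM ler_pM// normrM (ger0_norm a0).
by rewrite -[M]mulr1 ler_pM.
Qed.

(** Extends [turan_cvg] from polynomials to uniform limits of polynomials, in the one-sided form
    used later. The segment of radius [M'] contains both [[-M, M]] and [[-2, 2]]. *)
Lemma turan_test_le (M' : R) f (K : R) (m : nat) :
  M <= M' -> 2 <= M' -> continuous f -> poly_approx M' f ->
  (forall n, (m <= n)%N -> K <= \int[mu]_(x in D) (f x * (turan_poly n).[x])) ->
  K <= semicircle f.
Proof.
move=> MM' M'2 cf hf HK.
(* A uniform error [e'] costs at most [e' * c1] under the determinants and [e' * c2] under the
   semicircle law, so [e'] is chosen to make the total [e]. *)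
pose c1 := 2 * (1 + `|M|); pose c2 := semicircle (cst 1).
have c10 : 0 < c1 by rewrite /c1; have := normr_ge0 M; lra.
have c20 : 0 <= c2.
  rewrite mulr_ge0 ?invr_ge0 ?pi_ge0//; apply: Rintegral_ge0 => x _.
  by rewrite mul1r sqrtr_ge0.
apply/ler_addgt0Pr => e e0.
pose e' := e / (c1 + c2).
have e'0 : 0 < e' by rewrite divr_gt0//; lra.
have [q hq] := hf _ e'0.
have h1 : K - e' * c1 <= semicircle (horner q).
  apply: (cvgr_to_ge (@turan_cvg q)); exists m => // n /= mn.
  rewrite lerBlDr; apply: le_trans (HK n mn) _.
  (* The error term is dominated by a polynomial whose mean orthonormality gives exactly. *)
  have -> : poly_mean (q * turan_poly n) + e' * c1 =
    poly_mean (q * turan_poly n + (e' * (1 + `|M|)) *: (p n.+1 * p n.+1 + p n * p n)).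
    by rewrite poly_meanD poly_meanZ poly_meanD !poly_mean_orth !eqxx /c1 /=; ring.
  apply: le_Rintegral => //.
    apply: supp_integrable => x; apply: cvgM; first exact: cf.
    exact: continuous_horner.
  move=> x; rewrite /= in_itv/= -ler_norml => xM.
  have M0 := le_trans (normr_ge0 x) xM.
  have := turan_norm_le n xM; move: (turan_poly n) => T hT.
  rewrite hornerD hornerM hornerZ hornerD (ger0_norm M0).
  rewrite -lerBlDl -mulrBl; apply: le_trans (ler_norm _) _.
  rewrite normrM -mulrA ler_pM//; exact/hq/(le_trans xM).
have h2 : semicircle (horner q) <= semicircle f + e' * c2.
  rewrite /c2 /semicircle [e' * _]mulrCA -mulrDr ler_pM2l ?invr_gt0 ?pi_gt0//.
  have i1 : leb.-integrable `[(-2), 2] (EFin \o (fun x => cst 1 x * Num.sqrt (1 - x ^+ 2 / 4))).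
    by apply: sqrt_int => x; exact: cvg_cst.
  have mD2 : measurable (`[(-2), 2]%classic : set (measurableTypeR R)) by exact: measurable_itv.
  apply: (@le_trans _ _ (\int[leb]_(x in `[(-2), 2])
      ((f x + e') * Num.sqrt (1 - x ^+ 2 / 4)))).
    apply: le_Rintegral => //.
    - by apply: sqrt_int; exact: continuous_horner.
    - by apply: sqrt_int => x; apply: cvgD; [exact: cf|exact: cvg_cst].
    - move=> x; rewrite /= in_itv/= -ler_norml => x2.
      rewrite ler_wpM2r ?sqrtr_ge0//.
      by have := hq x (le_trans x2 M'2); rewrite ler_norml => /andP[+ _]; lra.
  rewrite -RintegralZl// -RintegralD//; [|exact: sqrt_int|]; last first.
    by have := integrableZl mD2 e' i1; apply: eq_integrable.
  rewrite le_eqVlt; apply/orP; left; apply/eqP; apply: eq_Rintegral => x _.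
  by rewrite mul1r mulrDl.
have : e' * (c1 + c2) = e by rewrite mulfVK// gt_eqF//; lra.
lra.
Qed.

End TuranLimit.

(** * Lebesgue differentiation and integration against a density *)

Section DensityTools.
Context {R : realType}.
Local Notation leb := (@lebesgue_measure R).

(** At a Lebesgue point, [H x] is the limit of its averages over balls of radius [1 / n.+1], and
    these eventually lie inside [|y| < c]. *)
Lemma ae_ge0_of_balls (H : R -> R) (c : R) :
  leb.-integrable setT (EFin \o H) ->
  (forall x r, 0 < r -> ball x r `<=` [set y | `|y| < c] ->
    (0 <= \int[leb]_(y in ball x r) (H y)%:E)%E) ->
  {ae leb, forall x, `|x| < c -> 0 <= H x}.
Proof.
move=> iH Hb.
have lH : locally_integrable [set: R] H by apply: open_integrable_locally => //; exact: openT.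
pose E (x : R) (n : nat) : set R := ball x n.+1%:R^-1.
have hE x : nicely_shrinking x (E x).
  split; first by move=> n; exact: measurable_ball.
  have inv0 n : 0 < n.+1%:R^-1 :> R by rewrite invr_gt0 ltr0n.
  exists (1, fun n => PosNum (inv0 n)); split => //=.
  - exact: cvg_harmonic.
  - by move=> n y.
  - by move=> n; rewrite mul1e.
move: (lebesgue_differentiation lH).
apply: filterS; first exact: (ae_filter_ringOfSetsType leb).
move=> x ptx xc; rewrite -lee_fin.
apply: (cvge_to_ge (@nice_lebesgue_differentiation _ _ hE _ lH _ ptx)).
have cx0 : 0 < c - `|x| by rewrite subr_gt0.
have := @near_infty_natSinv_lt R (PosNum cx0).
apply: filterS => n /= nc; rewrite mule_ge0//; first by rewrite inve_ge0.
apply: Hb; first by rewrite invr_gt0 ltr0n.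
move=> y; rewrite /ball/= => yx.
have := ler_normB x (x - y); rewrite subKr => h.
by apply: le_lt_trans h _; rewrite -ltrBrDl; exact: lt_trans yx nc.
Qed.

Lemma integral_subset0 d (T : measurableType d) (mu : {measure set T -> \bar R})
    (A B : set T) (f : T -> \bar R) : A `<=` B ->
  (forall x, ~ A x -> f x = 0%E) ->
  (\int[mu]_(x in B) f x = \int[mu]_(x in A) f x)%E.
Proof.
move=> AB f0; rewrite integral_mkcond [RHS]integral_mkcond.
congr integral; apply/funext => x; rewrite /patch.
case: ifPn => xB; case: ifPn => xA //.
  by rewrite f0//; move: xA; rewrite notin_setE.
by move: xB; rewrite notin_setE; case; apply: AB; rewrite inE in xA.
Qed.

Lemma density_integrable (mu : probability (measurableTypeR R) R) (w : R -> R) :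
  has_density mu w -> leb.-integrable setT (EFin \o w).
Proof.
move=> [mw w0 hw]; apply/integrableP; split; first exact/measurable_EFinP.
under eq_integral do rewrite /= ger0_norm//.
by rewrite -hw// probability_setT ltry.
Qed.

(** By uniqueness, [w] agrees almost everywhere with the Radon-Nikodym derivative of [mu], for which
    the change of variables is known. *)
Lemma density_change (mu : probability (measurableTypeR R) R) (w : R -> R)
    (D : set (measurableTypeR R)) (f : R -> R) :
  has_density mu w -> measurable D -> mu.-integrable D (EFin \o f) ->
  (\int[mu]_(x in D) (f x)%:E = \int[leb]_(x in D) (f x * w x)%:E)%E.
Proof.
move=> hw mD fi; have [mw w0 hwA] := hw.
have dom : mu `<< leb.
  apply/null_content_dominatesP => A mA lA; rewrite hwA//; apply: null_set_integral => //.
  by apply: measurable_funTS; exact/measurable_EFinP.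
rewrite -(Radon_Nikodym_change_of_variables dom mD fi).
have ae : ae_eq leb D (Radon_Nikodym (charge_of_finite_measure mu) leb) (EFin \o w).
  apply: (@ae_eq_subset _ _ _ _ _ setT) => //.
  apply: integral_ae_eq => //; [exact: Radon_Nikodym_integrable|exact/measurable_EFinP|].
  by move=> E _ mE; rewrite -Radon_Nikodym_integral//= hwA.
apply: ae_eq_integral => //.
- apply: emeasurable_funM; first exact: measurable_int fi.
  by apply: measurable_funTS; apply: measurable_int; exact: Radon_Nikodym_integrable.
- under eq_fun do rewrite EFinM.
  apply: emeasurable_funM; first exact: measurable_int fi.
  by apply: measurable_funTS; exact/measurable_EFinP.
- apply: filterS ae => x /= h Dx; by rewrite h// EFinM.
Qed.

End DensityTools.

(** * From inequalities on determinants to inequalities on [w] *)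

Section TuranDensity.
Context {R : realType}.
Variable mu : probability (measurableTypeR R) R.
Variable M : R.
Hypothesis mu_supp : mu (~` `[- M, M]) = 0%E.
Hypothesis M_ge2 : 2 <= M.
Variables (a : nat -> R) (p : nat -> {poly R}).
Hypothesis a_ge0 : forall n, 0 <= a n.+1.
Hypothesis a_le1 : forall n, a n.+1 <= 1.
Hypothesis a_cvg : a @ \oo --> (1 : R).
Hypothesis p_orth : forall m n,
  (\int[mu]_x ((p m).[x] * (p n).[x])%:E)%E = ((m == n)%:R : R)%:E.
Hypothesis p_rec : forall n, 'X * p n.+1 = a n.+2 *: p n.+2 + a n.+1 *: p n.
Variable w : R -> R.
Hypothesis mu_w : has_density mu w.
Local Notation leb := (@lebesgue_measure R).
Local Notation rho x := (Num.sqrt (1 - x ^+ 2 / 4)).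

Lemma turan_density_le (A B : {poly R}) (c : R) (m : nat) : c <= 2 ->
  (forall n x, (m <= n)%N -> `|x| < c -> B.[x] <= A.[x] * (turan_poly a p n).[x]) ->
  {ae leb, forall x, `|x| < c -> B.[x] * w x <= pi^-1 * (A.[x] * rho x)}.
Proof.
move=> c2 AB; have [mw w0 _] := mu_w.
pose D2 := (`[(-2), 2]%classic : set (measurableTypeR R)).
pose H0 (x : R) := pi^-1 * (A.[x] * rho x) - B.[x] * w x.
have mD2 : measurable D2 by exact: measurable_itv.
have cAr : continuous (fun x => pi^-1 * (A.[x] * rho x)).
  move=> x; apply: cvgM; first exact: cvg_cst.
  apply: cvgM; first exact: continuous_horner.
  apply: (@continuous_comp _ _ _ (fun x : R => 1 - x ^+ 2 / 4) (@Num.sqrt R)).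
    apply: cvgB; first exact: cvg_cst.
    by apply: cvgM; [exact: exprn_continuous|exact: cvg_cst].
  exact: sqrt_continuous.
have iw : leb.-integrable D2 (EFin \o w).
  exact: integrableS measurableT mD2 (@subsetT _ _) (density_integrable mu_w).
have iBw (f : R -> R) : continuous f ->
    leb.-integrable D2 (EFin \o (fun x => f x * w x)).
  move=> cf; have : leb.-integrable D2 ((EFin \o f) \* (EFin \o w))%E.
    apply: integrableMr => //.
      by apply: measurable_funTS; exact: continuous_measurable_fun.
    have /compact_bounded[b [_ mrt]] : compact (f @` (`[(-2), 2] : set R)).
      by apply: continuous_compact; [exact: continuous_subspaceT|exact: segment_compact].
    by exists b; split; rewrite ?num_real // => ? ? ? ?; exact: mrt.
  by apply: eq_integrable.
have iH0 : leb.-integrable D2 (EFin \o H0).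
  have : leb.-integrable D2
    ((EFin \o (fun x => (pi^-1 * (A.[x] * rho x))%R)) \- (EFin \o (fun x => (B.[x] * w x)%R)))%E.
    apply: integrableB => //; first exact: itv_integrable.
    by apply: iBw; exact: continuous_horner.
  by apply: eq_integrable.
pose H := H0 \_ D2.
have iH : leb.-integrable setT (EFin \o H).
  by rewrite /H -restrict_EFin; apply/integrable_restrict => //; rewrite setTI.
have sub2 x : `|x| < c -> D2 x.
  by move=> xc; rewrite /D2/= in_itv/= -ler_norml; apply: le_trans c2; exact: ltW.
suff : {ae leb, forall x, `|x| < c -> 0 <= H x}.
  apply: filterS; first exact: (ae_filter_ringOfSetsType leb).
  move=> x /= h xc; have := h xc.
  by rewrite /H patchE mem_set ?subr_ge0//; exact: sub2.
apply: ae_ge0_of_balls => // x r r0 xr.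
have mball : measurable (ball x r : set (measurableTypeR R)) by exact: measurable_ball.
have ball2 : ball x r `<=` D2 by move=> y /xr; exact: sub2.
have iHb : leb.-integrable (ball x r) (EFin \o H).
  exact: integrableS measurableT mball (@subsetT _ _) iH.
pose t (k : nat) := tent k%:R x r.
have t_cvg y : ball x r y -> t k y @[k --> \oo] --> (1 : R).
  rewrite /ball/= distrC => xy; apply: cvg_near_cst.
  have d0 : 0 < r - `|y - x| by rewrite subr_gt0.
  exists (Num.truncn (r - `|y - x|)^-1).+1 => // k /= hk.
  apply: tent_in; rewrite -ler_pdivrMr// mul1r ltW//.
  by apply: lt_le_trans (truncnS_gt _) _; rewrite ler_nat.
(* The tents tend to 1 on the ball with [|H|] as dominating function, so it suffices to bound the
   integral of [t k y * H y] from below by 0 for each [k]. *)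
have [|||||_ _] := @dominated_convergence _ _ _ leb _ mball
  (fun k y => (t k y * H y)%:E) (EFin \o H) (fun y => `|(EFin \o H) y|)%E.
- move=> k; apply/measurable_EFinP; apply: measurable_funM.
    apply: measurable_funTS; apply: continuous_measurable_fun.
    exact: continuous_tent.
  by apply/measurable_EFinP; exact: measurable_int iHb.
- exact: measurable_int iHb.
- apply: aeW => y yb; apply: cvg_EFin; first exact: nearW.
  rewrite -[X in _ --> X]mul1r; apply: cvgM; last exact: cvg_cst.
  exact: t_cvg.
- exact: integrable_abse.
- apply: aeW => y k yb; rewrite /= lee_fin normrM.
  have /andP[t0 t1] := tent_bounds k%:R x r y.
  by rewrite -[leRHS]mul1r ler_wpM2r// ger0_norm.
move=> /cvge_to_ge; apply; apply: nearW => k /=.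
have t_out y : ~ ball x r y -> t k y = 0.
  by move=> xy; apply: tent_out => //; rewrite leNgt distrC; apply/negP.
have ct : continuous (t k) by exact: continuous_tent.
have HE : (\int[leb]_(y in ball x r) (t k y * H y)%:E =
   \int[leb]_(y in D2) (pi^-1 * ((A.[y] * t k y) * rho y))%:E -
   \int[leb]_(y in D2) (B.[y] * t k y * w y)%:E)%E.
  rewrite -integralB//; last 2 first.
  - apply: itv_integrable => y; have -> : (fun y => pi^-1 * ((A.[y] * t k y) * rho y)) =
       (fun y => pi^-1 * (A.[y] * rho y) * t k y) by apply/funext => z; ring.
    by apply: cvgM; [exact: cAr|exact: ct].
  - by apply: iBw => y; apply: cvgM; [exact: continuous_horner|exact: ct].
  rewrite [RHS](@integral_subset0 _ _ _ leb (ball x r) D2 _ ball2); last first.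
    by move=> y /t_out ->; rewrite !mulr0 !mul0r mulr0 -EFinB subrr.
  apply: eq_integral => y; rewrite inE => yb.
  rewrite -EFinB /H patchE mem_set; last exact: ball2.
  by rewrite /H0; congr EFin; ring.
have cAt : continuous (fun y => A.[y] * t k y).
  by move=> y; apply: cvgM; [exact: continuous_horner|exact: ct].
have cBt : continuous (fun y => B.[y] * t k y).
  by move=> y; apply: cvgM; [exact: continuous_horner|exact: ct].
pose DM := (`[- M, M]%classic : set (measurableTypeR R)).
have mDM : measurable DM by exact: measurable_itv.
have iBt : mu.-integrable DM (EFin \o (fun y => B.[y] * t k y)).
  exact: supp_integrable.
have D2M : D2 `<=` DM.
  by move=> y; rewrite /D2 /DM/= !in_itv/= -!ler_norml => /le_trans; apply.
have le1 : \int[mu]_(y in DM) (B.[y] * t k y) <= semicircle (fun y => A.[y] * t k y).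
  apply: (@turan_test_le _ _ _ mu_supp _ _ a_ge0 a_le1 a_cvg p_orth p_rec _ _ _ m
    (lexx M) M_ge2 cAt) => //.
    by apply: poly_approxMl; exact: poly_approx_tent.
  move=> n mn; apply: le_Rintegral => //.
    apply: supp_integrable => y; apply: cvgM; first exact: cAt.
    exact: continuous_horner.
  (* Outside the ball the tent vanishes, so [AB] is invoked only where [|y| < c]. *)
  move=> y _; have [yb|yb] := pselect (ball x r y); last by rewrite t_out// !mulr0 mul0r.
  rewrite mulrAC ler_wpM2r//; first by have /andP[] := tent_bounds k%:R x r y.
  exact: AB n y mn (xr _ yb).
have iBtw := iBw _ cBt.
have iAtr : leb.-integrable D2 (EFin \o (fun y => A.[y] * t k y * rho y)).
  apply: itv_integrable => y; apply: cvgM; first exact: cAt.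
  apply: (@continuous_comp _ _ _ (fun x : R => 1 - x ^+ 2 / 4) (@Num.sqrt R)).
    apply: cvgB; first exact: cvg_cst.
    by apply: cvgM; [exact: exprn_continuous|exact: cvg_cst].
  exact: sqrt_continuous.
have E1 : (\int[leb]_(y in D2) (B.[y] * t k y * w y)%:E =
    (\int[mu]_(y in DM) (B.[y] * t k y))%:E)%E.
  rewrite /Rintegral fineK; last exact: integrable_fin_num.
  rewrite (density_change mu_w mDM iBt) (integral_subset0 _ D2M)// => y yD.
  rewrite t_out ?mulr0 ?mul0r// => /ball2; exact: yD.
have E2 : (\int[leb]_(y in D2) (pi^-1 * ((A.[y] * t k y) * rho y))%:E =
    (semicircle (fun y => A.[y] * t k y))%:E)%E.
  rewrite /semicircle EFinM /Rintegral fineK; last exact: integrable_fin_num.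
  rewrite -integralZl//.
by rewrite HE E1 E2 -EFinB lee_fin subr_ge0.
Qed.

End TuranDensity.

(** * Comparison of [S_{N+2}], which is [turan a x u N.+1], with [P^2 = e^{2 g}] *)

Section PointwiseBounds.
Context {R : realType}.
Variables (a : nat -> R) (x : R) (u : nat -> R) (lam : nat -> R) (N : nat).
Hypothesis a_gt0 : forall n, 0 < a n.+1.
Hypothesis a_nd : forall n, a n.+1 <= a n.+2.
Hypothesis a_le1 : forall n, a n.+1 <= 1.
Hypothesis x_ge0 : 0 <= x.
Hypothesis x_lt2 : x < 2.
Hypothesis x_lt : x < 2 * a N.+1.
Hypothesis u_rec : forall n, x * u n.+1 = a n.+2 * u n.+2 + a n.+1 * u n.
Hypothesis u0 : u 0%N = 1.
Hypothesis u1 : x = a 1%N * u 1%N.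
Hypothesis lam_ge1 : forall n, (n < N)%N -> 1 <= lam n.+1.
Hypothesis lamE : forall n, (n < N)%N -> x = a n.+1 * (lam n.+1 + (lam n.+1)^-1).

Local Notation P := (\prod_(1 <= j < N.+1) lam j).
Local Notation N1 := ((maxn N 1)%:R : R).
Local Notation delta := (a N.+2 - a N.+1).
Local Notation kappa := (a N.+2 ^+ 2 - x ^+ 2 / 4).
Local Notation r := (3 / a 1%N).

Let a1_le n : a 1%N <= a n.+1.
Proof. by elim: n => // n IH; exact: (le_trans IH (a_nd n)). Qed.

Let r_ge3 : 3 <= r.
Proof. by rewrite ler_pdivlMr//; have := a_le1 0; lra. Qed.

Let sqr_le (y z : R) : 0 <= y -> y <= z -> y ^+ 2 <= z ^+ 2.
Proof. by move=> y0 yz; rewrite lerXn2r// nnegrE; exact: le_trans yz. Qed.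

(** From [x < 2 a_{N+1}], [kappa] is at least [a_{N+2}^2 - a_{N+1}^2 = delta * (a_{N+2} +
    a_{N+1})]. *)
Lemma kappa_ge : 2 * a 1%N * delta <= kappa.
Proof.
have h1 := a1_le N; have h2 := a_nd N; have h3 := a_gt0 0; have h4 := a_gt0 N.
have := sqr_le x_ge0 (ltW x_lt).
have : 0 <= (a N.+2 - a N.+1) * (a N.+2 + a N.+1 - 2 * a 1%N).
  by rewrite mulr_ge0; lra.
lra.
Qed.

Lemma kappa_ge0 : 0 <= kappa.
Proof.
apply: le_trans kappa_ge; rewrite mulr_ge0 ?subr_ge0// mulr_ge0// ltW//.
Qed.

(** The recurrence writes [a_{N+1} u_N], which is at least [a_1 P], through [u_{N+1}] and [u_{N+2}];
    by Cauchy-Schwarz its square is at most 5 times the sum of their squares, and [kappa] times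
    either square is at most the determinant. The 27 is [(a_1 r)^3]. *)
Lemma turan_lower : 27 * delta * P ^+ 2 <= 5 * r ^+ 3 * turan a x u N.+1.
Proof.
have P0 : 0 <= P.
  rewrite big_nat; apply: prodr_ge0 => -[|j]// /andP[_ jN].
  by apply: le_trans (lam_ge1 _) => //.
have PN : P <= u N := growth_lower a_gt0 a_nd u_rec u0 u1 lam_ge1 lamE (leqnn N).
set T := turan a x u N.+1; set k := kappa.
have T1 : k * u N.+1 ^+ 2 <= T := turan_ge a x u N.+1.
have T2 : k * u N.+2 ^+ 2 <= T := turan_geS a x u N.+1.
have k0 : 0 <= k := kappa_ge0.
have a0 := a_gt0 0.
have h1 : (a 1%N * P) ^+ 2 <= (x * u N.+1 - a N.+2 * u N.+2) ^+ 2.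
  rewrite u_rec addrAC subrr add0r; apply: sqr_le.
    by rewrite mulr_ge0// ltW.
  by apply: ler_pM => //; exact: ltW.
have h2 : (x * u N.+1 - a N.+2 * u N.+2) ^+ 2 <= 5 * (u N.+1 ^+ 2 + u N.+2 ^+ 2).
  have e1 : x ^+ 2 + a N.+2 ^+ 2 <= 5.
    have := sqr_le x_ge0 (ltW x_lt2).
    have : a N.+2 ^+ 2 <= 1 by rewrite expr_le1// ltW.
    by lra.
  apply: (@le_trans _ _ ((x ^+ 2 + a N.+2 ^+ 2) * (u N.+1 ^+ 2 + u N.+2 ^+ 2))).
    by have := sqr_ge0 (x * u N.+2 + a N.+2 * u N.+1); lra.
  by rewrite ler_wpM2r// addr_ge0 ?sqr_ge0.
have h3 : k * (a 1%N * P) ^+ 2 <= 10 * T.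
  have := ler_wpM2l k0 (le_trans h1 h2); lra.
have h4 : 2 * a 1%N * delta * (a 1%N * P) ^+ 2 <= 10 * T.
  by apply: le_trans h3; rewrite ler_wpM2r ?sqr_ge0// kappa_ge.
have -> : 27 * delta * P ^+ 2 =
    r ^+ 3 / 2 * (2 * a 1%N * delta * (a 1%N * P) ^+ 2) by field; rewrite gt_eqF.
have -> : 5 * r ^+ 3 * T = r ^+ 3 / 2 * (10 * T) by field; rewrite gt_eqF.
have r0 : 0 <= r by rewrite divr_ge0// ltW.
by apply: ler_wpM2l h4; rewrite divr_ge0// exprn_ge0.
Qed.

(** [growth_upper] bounds [u_N], and each of the two further steps of the recurrence costs at most a
    factor [r]. *)
Lemma turan_upper : turan a x u N.+1 <= 16 * r ^+ 6 * N1 ^+ 2 * P ^+ 2.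
Proof.
have x0 := x_ge0; have x2 := x_lt2.
have P0 : 0 <= P.
  rewrite big_nat; apply: prodr_ge0 => -[|j]// /andP[_ jN].
  by apply: le_trans (lam_ge1 _) => //.
have a0 := a_gt0 0.
have uN := growth_upper a_gt0 a_nd x_ge0 u_rec u0 u1 lam_ge1 lamE (leqnn N).
have uN0 : 0 <= u N.
  apply: le_trans P0 _; exact: (growth_lower a_gt0 a_nd u_rec u0 u1 lam_ge1 lamE (leqnn N)).
have r3 := r_ge3.
have N11 : 1 <= N1 by rewrite ler1n leq_maxr.
have NN1 : N%:R <= N1 by rewrite ler_nat leq_maxl.
have xr : x / a 1%N <= r by rewrite ler_wpM2r ?invr_ge0//; lra.
(* The 3 in [r = 3 / a_1] comes from [x <= 2] and [a_n <= 1] as coefficients of the two earlier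
   terms; the division is by at least [a_1]. *)
have step n (y z K : R) : 0 <= K -> a n.+1 * y = z -> `|z| <= 3 * K -> `|y| <= r * K.
  move=> K0 yz zK; rewrite mulrAC ler_pdivlMr//.
  apply: le_trans zK; rewrite -yz normrM mulrC (gtr0_norm (a_gt0 _)).
  by rewrite ler_wpM2r.
have uN_upper : u N <= 2 * r * N1 * P.
  apply: le_trans uN _; rewrite ler_wpM2r//.
  have h1 : N%:R * (x / a 1%N) <= N1 * r by rewrite ler_pM// divr_ge0// ltW.
  have h2 : 1 <= N1 * r by rewrite -[1]mulr1 ler_pM//; lra.
  by lra.
have uS : `|u N.+1| <= r * u N.
  (* For [N = 0] there is no [u_{N-1}], and the initial relation [u1] replaces the recurrence. *)
  have [N0|N0] := posnP N.
    rewrite N0; apply: (step 0%N _ x) => //; first by rewrite u0.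
    by rewrite u0 ger0_norm; lra.
  case: N N0 uN0 lam_ge1 lamE => // n _ un0 l1 lE.
  apply: (step n.+1 _ (x * u n.+1 - a n.+1 * u n)) => //; first by rewrite u_rec addrK.
  have [v0 vS] := growth_step a_gt0 a_nd u_rec u0 u1 l1 lE (ltnSn n).
  have vv : u n <= u n.+1.
    by apply: le_trans vS; rewrite ler_peMl ?l1// ltW.
  apply: le_trans (ler_normB _ _) _.
  rewrite !normrM (ger0_norm x_ge0) (ger0_norm un0) (gtr0_norm (a_gt0 _)) (gtr0_norm v0).
  have : x * u n.+1 <= 2 * u n.+1 by rewrite ler_wpM2r// ltW.
  have : a n.+1 * u n <= 1 * u n by rewrite ler_wpM2r// ltW.
  by lra.
have uSS : `|u N.+2| <= r * (r * u N).
  have ruN : 0 <= r * u N by rewrite mulr_ge0//; lra.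
  have uru : u N <= r * u N by rewrite ler_peMl//; lra.
  apply: (step N.+1 _ (x * u N.+1 - a N.+1 * u N)) => //; first by rewrite u_rec addrK.
  apply: le_trans (ler_normB _ _) _.
  rewrite !normrM (ger0_norm x_ge0) (ger0_norm uN0) (gtr0_norm (a_gt0 _)).
  have : x * `|u N.+1| <= 2 * (r * u N) by rewrite ler_pM// ltW.
  have : a N.+1 * u N <= 1 * u N by rewrite ler_wpM2r.
  by lra.
have sq (y z : R) : `|y| <= z -> y ^+ 2 <= z ^+ 2.
  by move=> yz; rewrite -real_normK ?num_real//; exact: sqr_le.
have s1 := sq _ _ uS; have s2 := sq _ _ uSS.
have s3 : turan a x u N.+1 <= 2 * (u N.+2 ^+ 2 + u N.+1 ^+ 2).
  have q1 : a N.+2 ^+ 2 <= 1 by rewrite expr_le1// ltW.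
  have q2 : a N.+2 ^+ 2 * (u N.+2 ^+ 2 + u N.+1 ^+ 2) <= 1 * (u N.+2 ^+ 2 + u N.+1 ^+ 2).
    by rewrite ler_wpM2r// addr_ge0 ?sqr_ge0.
  have q3 : `|x * a N.+2 * u N.+2 * u N.+1| <= u N.+2 ^+ 2 + u N.+1 ^+ 2.
    rewrite -mulrA normrM [`|x * _|]ger0_norm ?mulr_ge0 ?(ltW (a_gt0 _))//.
    apply: (@le_trans _ _ (2 * `|u N.+2 * u N.+1|)).
      by rewrite ler_wpM2r// -[2]mulr1 ler_pM// ltW.
    rewrite normrM -[u N.+2 ^+ 2]real_normK ?num_real// -[u N.+1 ^+ 2]real_normK ?num_real//.
    by have := sqr_ge0 (`|u N.+2| - `|u N.+1|); lra.
  by move: q3; rewrite /turan ler_norml => /andP[q3 _]; lra.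
have s4 : u N ^+ 2 <= (2 * r * N1 * P) ^+ 2 by apply: sq; rewrite ger0_norm.
have r21 : 1 <= r ^+ 2 by rewrite expr_ge1//; lra.
have r40 : 0 <= r ^+ 4 by rewrite exprn_ge0//; lra.
have s5 : r ^+ 2 * u N ^+ 2 <= r ^+ 4 * u N ^+ 2.
  rewrite ler_wpM2r ?sqr_ge0// (_ : r ^+ 4 = r ^+ 2 * r ^+ 2); last by ring.
  by rewrite ler_peMr// (le_trans ler01).
have s6 := ler_wpM2l r40 s4.
have E : 4 * (r ^+ 4 * (2 * r * N1 * P) ^+ 2) = 16 * r ^+ 6 * N1 ^+ 2 * P ^+ 2 by ring.
rewrite -E; apply: le_trans s3 _.
have e1 : (r * u N) ^+ 2 = r ^+ 2 * u N ^+ 2 by ring.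
have e2 : (r * (r * u N)) ^+ 2 = r ^+ 4 * u N ^+ 2 by ring.
rewrite e1 in s1; rewrite e2 in s2.
by lra.
Qed.

(** The hypotheses place [T * W] between [kappa / 4] and 1, using [2 <= pi <= 4] and [rho <= 1].
    Replacing [T] by [P^2] through [turan_upper] and [turan_lower] gives the two sides;
    [4 r^4 N1 / delta] is a common crude constant. *)
Lemma weight_bounds (W : R) : 0 < delta ->
  turan a x u N.+1 * W <= pi^-1 * Num.sqrt (1 - x ^+ 2 / 4) ->
  pi^-1 * (kappa * Num.sqrt (1 - x ^+ 2 / 4)) <=
    turan a x u N.+1 * (1 - x ^+ 2 / 4) * W ->
  0 <= W ->
  (4 * r ^+ 4 * N1 / delta) ^- 2 <= P ^+ 2 * W <= (4 * r ^+ 4 * N1 / delta) ^+ 2.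
Proof.
move=> d0 H1 H2 W0; have r3 := r_ge3; have a0 := a_gt0 0.
set rho := Num.sqrt _ in H1 H2; set T := turan _ _ _ _ in H1 H2.
have x2 : 0 < 1 - x ^+ 2 / 4.
  have : x ^+ 2 < 2 ^+ 2 by rewrite ltrXn2r// nnegrE.
  lra.
have rho0 : 0 < rho by rewrite sqrtr_gt0.
have rho2 : 1 - x ^+ 2 / 4 = rho ^+ 2 by rewrite sqr_sqrtr// ltW.
have rho1 : rho <= 1.
  rewrite -(expr_le1 (isT : (0 < 2)%N) (ltW rho0)) -rho2.
  by have := sqr_ge0 x; lra.
have pi2 := @pi_ge2 R.
have pi4 : pi <= 4 :> R by have /andP[_] := @pihalf_02 R; lra.
have pi0 : 0 < pi :> R by exact: pi_gt0.
have N11 : 1 <= N1 by rewrite ler1n leq_maxr.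
have d1 : delta <= 1 by have := a_le1 N.+1; have := a_gt0 N; lra.
have T0 : 0 <= T.
  apply: le_trans (turan_ge a x u N.+1); rewrite mulr_ge0 ?sqr_ge0//; exact: kappa_ge0.
have TW1 : T * W <= 1.
  apply: le_trans H1 _; rewrite -[1]mulr1 ler_pM ?invr_ge0//; try lra.
  by rewrite invf_le1//; lra.
have kTW : kappa / 4 <= T * W.
  have h : pi^-1 * kappa <= T * rho * W.
    rewrite -(ler_pM2r rho0); move: H2; rewrite rho2; lra.
  apply: (@le_trans _ _ (pi^-1 * kappa)).
    by rewrite mulrC ler_wpM2r ?kappa_ge0// lef_pV2 ?posrE.
  apply: le_trans h _; rewrite -mulrA [rho * W]mulrC mulrA.
  by rewrite ler_piMr// mulr_ge0.
have TL := turan_lower; have TU := turan_upper; have kg := kappa_ge.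
rewrite -/T in TL TU.
set Y := P ^+ 2 * W.
have Y0 : 0 <= Y by rewrite mulr_ge0// sqr_ge0.
have r0 : 0 < r by lra.
have r1 : 1 <= r by lra.
have rX n : 1 <= r ^+ n by rewrite exprn_ege1.
apply/andP; split.
  have u1' : kappa / 4 <= 16 * r ^+ 6 * N1 ^+ 2 * Y.
    by apply: le_trans kTW _; have := ler_wpM2r W0 TU; rewrite /Y; lra.
  have u2 : 3 / (2 * r) * delta <= 16 * r ^+ 6 * N1 ^+ 2 * Y.
    apply: le_trans u1'; have -> : 3 / (2 * r) * delta = 2 * a 1%N * delta / 4.
      by field; rewrite gt_eqF.
    by rewrite ler_wpM2r.
  have C0 : 0 < (4 * r ^+ 4 * N1 / delta) ^+ 2.
    by rewrite exprn_gt0// divr_gt0// !mulr_gt0// ?exprn_gt0//; lra.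
  rewrite -[X in X <= _]div1r ler_pdivrMr// .
  have -> : Y * (4 * r ^+ 4 * N1 / delta) ^+ 2 =
    (16 * r ^+ 6 * N1 ^+ 2 * Y) * (r ^+ 2 / delta ^+ 2).
    by field; rewrite !gt_eqF//; lra.
  apply: (@le_trans _ _ (3 / (2 * r) * delta * (r ^+ 2 / delta ^+ 2))).
    have -> : 3 / (2 * r) * delta * (r ^+ 2 / delta ^+ 2) = 3 * r / 2 / delta.
      by field; rewrite !gt_eqF//; lra.
    by rewrite ler_pdivlMr//; lra.
  rewrite ler_wpM2r// divr_ge0// ?sqr_ge0//.
have v1 : 27 * delta * Y <= 5 * r ^+ 3.
  have := ler_wpM2r W0 TL; rewrite -[5 * _ * T * W]mulrA => h.
  have : 5 * r ^+ 3 * (T * W) <= 5 * r ^+ 3 * 1.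
    by rewrite ler_wpM2l// mulr_ge0// exprn_ge0// ltW.
  by rewrite /Y; lra.
have v2 : Y <= r ^+ 3 / delta.
  rewrite ler_pdivlMr//; have := rX 3%N; have : 0 <= delta * Y by rewrite mulr_ge0// ltW.
  by lra.
apply: le_trans v2 _.
have -> : (4 * r ^+ 4 * N1 / delta) ^+ 2 = (r ^+ 3 / delta) * (16 * r ^+ 5 * N1 ^+ 2 / delta).
  by field; rewrite !gt_eqF//; lra.
have rd0 : 0 <= r ^+ 3 / delta by rewrite divr_ge0// ?(ltW d0)// exprn_ge0// ltW.
rewrite ler_peMr//.
rewrite ler_pdivlMr// mul1r; apply: le_trans d1 _.
have : 1 <= r ^+ 5 * N1 ^+ 2 by rewrite mulr_ege1// ?rX// exprn_ege1.
lra.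
Qed.

End PointwiseBounds.

(* Replacing [p_n(x)] by [sgn(x)^n p_n(x)] reduces the recurrence to [x >= 0]. *)
Section Alternating.
Context {R : realType}.
Variables (a : nat -> R) (x s : R) (u : nat -> R).
Hypothesis s_sqr : s ^+ 2 = 1.

Lemma alternating_rec n : x * u n.+1 = a n.+2 * u n.+2 + a n.+1 * u n ->
  s * x * (s ^+ n.+1 * u n.+1) =
    a n.+2 * (s ^+ n.+2 * u n.+2) + a n.+1 * (s ^+ n * u n).
Proof.
move=> h; rewrite mulrACA -exprS h.
have -> : s ^+ n.+2 = s ^+ n by rewrite -addn2 exprD s_sqr mulr1.
by ring.
Qed.

Lemma turan_alternating n :
  turan a (s * x) (fun n => s ^+ n * u n) n = turan a x u n.
Proof.
rewrite /turan !exprMn -!exprM ![(_ * 2)%N]mulnC !exprM s_sqr !expr1n !mul1r.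
have e : s * s ^+ n.+1 * s ^+ n = 1.
  rewrite -exprS -exprD (_ : (n.+2 + n = 2 * n.+1)%N); last first.
    by rewrite mul2n -addnn addnS.
  by rewrite exprM s_sqr expr1n.
congr (_ - _).
transitivity (s * s ^+ n.+1 * s ^+ n * (x * a n.+1 * u n.+1 * u n)); first by ring.
by rewrite e mul1r.
Qed.

End Alternating.

(** * Reduction to a segment, passage to logarithms, and the final assembly *)

Lemma supported_in_segment (R : realType) (mu : probability (measurableTypeR R) R) :
  compactly_supported mu -> exists2 M : R, 2 <= M & mu (~` `[- M, M]) = 0%E.
Proof.
move=> [K cK muK]; have [M [_ hM]] := compact_bounded cK.
exists (Num.max 2 (M + 1)); first by rewrite le_max lexx.
have mK : measurable (K : set (measurableTypeR R)) by exact: compact_measurable.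
have mI : measurable (`[- Num.max 2 (M + 1), Num.max 2 (M + 1)]%classic : set (measurableTypeR R)).
  exact: measurable_itv.
apply: (subset_measure0 (measurableC mI) (measurableC mK)) muK.
apply: subsetC => y Ky; rewrite /= in_itv/= -ler_norml.
by rewrite le_max; apply/orP; right; apply: hM => //; rewrite ltrDl.
Qed.

(* [|-ln W / 2 - ln P| <= ln E] amounts to [E^-2 <= P^2 W <= E^2]. *)
Lemma log_bounds (R : realType) (W P E : R) : 0 < W -> 0 < P -> 0 < E ->
  E ^- 2 <= P ^+ 2 * W <= E ^+ 2 -> `|- ln W / 2 - ln P| <= ln E.
Proof.
move=> W0 P0 E0; have PW0 : 0 < P ^+ 2 * W by rewrite mulr_gt0// exprn_gt0.
have En0 : 0 < E ^+ 2 by rewrite exprn_gt0.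
move=> /andP[h1 h2].
have {}h1 : ln (E ^- 2) <= ln (P ^+ 2 * W) by rewrite ler_ln ?posrE ?invr_gt0.
have {}h2 : ln (P ^+ 2 * W) <= ln (E ^+ 2) by rewrite ler_ln ?posrE.
move: h1 h2; rewrite lnV ?posrE// lnM ?posrE ?exprn_gt0// !lnXn// ![ln _ *+ 2]mulr2n => h1 h2.
by rewrite ler_norml; apply/andP; split; lra.
Qed.

Theorem theorem3p1 (R : realType) (a b : nat -> R)
    (hb : forall n : nat, (1 <= n)%N -> b n = 0)
    (ha : forall n : nat, (1 <= n)%N ->
       [/\ 0 < a n, a n <= a n.+1 & a n.+1 <= 1])
    (ha_lim : a @ \oo --> (1 : R))
    (mu : probability (measurableTypeR R) R) (w : R -> R)
    (hmu : jacobi_measure a b mu)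
    (hw : has_density mu w)
    (N : R -> nat)
    (hN : forall x : R, -2 < x < 2 ->
       (forall n : nat, (1 <= n <= N x)%N -> 2 * a n <= `|x|) /\
       (forall n : nat, (N x < n)%N -> `|x| < 2 * a n))
    (gamma : nat -> R -> R)
    (hgamma : forall x : R, -2 < x < 2 ->
       forall n : nat, (1 <= n <= N x)%N ->
         0 <= gamma n x /\ `|x| / a n = 2 * cosh (gamma n x)) :
  exists (C : R) (Q : R -> R),
    [/\ 0 < C,
        {ae lebesgue_measure, forall x : R, -2 < x < 2 ->
           w x = expR (- 2 * Q x)} &
        forall x : R, -2 < x < 2 ->
          (`|Q x - \sum_(1 <= j < (N x).+1) gamma j x|%:E
             <= error_bound C a (N x))%E].
Proof.
have [/supported_in_segment[M M2 muM] [p [_ p_orth] [p0 rec]]] := hmu.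
have a_gt0 n : 0 < a n.+1 by case: (ha n.+1).
have a_nd n : a n.+1 <= a n.+2 by case: (ha n.+1).
have a_le1 n : a n.+1 <= 1 by apply: le_trans (a_nd n) _; case: (ha n.+1).
have a_ge0 n : 0 <= a n.+1 by exact: ltW.
have p_rec n : 'X * p n.+1 = a n.+2 *: p n.+2 + a n.+1 *: p n.
  by rewrite rec hb// scale0r addr0.
have p1 : 'X = a 1%N *: p 1%N.
  by have := rec 0%N; rewrite p0 mulr1 hb// scale0r addr0 scaler0 addr0.
pose u x n := (p n).[x].
have u_rec x n : x * u x n.+1 = a n.+2 * u x n.+2 + a n.+1 * u x n.
  by have := congr1 (horner^~ x) (p_rec n); rewrite /= hornerM hornerX hornerD !hornerZ.
have [_ w0 _] := hw.
pose T n x := turan a x (u x) n.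
pose rho (x : R) := Num.sqrt (1 - x ^+ 2 / 4).
(* Taken with [A = 1] and [B] the fixed determinant, since determinants increase with their
   index. *)
have upper m : {ae lebesgue_measure, forall x, `|x| < 2 * a m.+1 ->
    T m x * w x <= pi^-1 * rho x}.
  have c2 : 2 * a m.+1 <= 2 by have := a_le1 m; lra.
  apply: filterS (@turan_density_le R mu M muM M2 a p a_ge0 a_le1 ha_lim p_orth p_rec w hw
    1 (turan_poly a p m) (2 * a m.+1) m c2 _).
    exact: (ae_filter_ringOfSetsType lebesgue_measure).
    by move=> x h xm; have := h xm; rewrite turan_polyE hornerC mul1r.
  move=> n x mn xm; rewrite hornerC mul1r !turan_polyE -(subnKC mn).
  by apply: turan_nd => // k; exact: u_rec.
have lower m : {ae lebesgue_measure, forall x, `|x| < 2 * a m.+1 ->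
    pi^-1 * ((a m.+1 ^+ 2 - x ^+ 2 / 4) * rho x) <= T m x * (1 - x ^+ 2 / 4) * w x}.
  (* [turan_ratio] bounds later determinants from above while [turan_density_le] expects a bound
     from below, so both sides enter negated. *)
  pose qA : {poly R} := 4^-1 *: 'X^2 - (a m.+1 ^+ 2)%:P.
  pose qB : {poly R} := turan_poly a p m * (4^-1 *: 'X^2 - 1).
  have qAE x : qA.[x] = - (a m.+1 ^+ 2 - x ^+ 2 / 4).
    by rewrite hornerD hornerN hornerC hornerZ hornerXn; ring.
  have qBE x : qB.[x] = - (T m x * (1 - x ^+ 2 / 4)).
    rewrite hornerM (turan_polyE a p m x : _ = T m x) hornerD hornerN hornerC hornerZ.
    by rewrite hornerXn; ring.
  have c2 : 2 * a m.+1 <= 2 by have := a_le1 m; lra.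
  apply: filterS (@turan_density_le R mu M muM M2 a p a_ge0 a_le1 ha_lim p_orth p_rec w hw
    qA qB (2 * a m.+1) m c2 _); first exact: (ae_filter_ringOfSetsType lebesgue_measure).
    move=> x h xm; have := h xm; rewrite qAE qBE !mulNr mulrN lerN2.
    by [].
  move=> n x mn xm; rewrite qAE qBE mulNr lerN2 turan_polyE -(subnKC mn) [leRHS]mulrC.
  apply: turan_ratio => // [k|]; first exact: u_rec.
  have : `|x| ^+ 2 <= (2 * a m.+1) ^+ 2.
    by apply: lerXn2r; rewrite ?nnegrE ?mulr_ge0//; exact: ltW.
  by rewrite real_normK ?num_real//; lra.
pose r := 3 / a 1%N.
have r0 : 0 < r by rewrite divr_gt0.
have r1 : 1 <= r by rewrite ler_pdivlMr//; have := a_le1 0; lra.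
pose C := 4 * r ^+ 4.
have C1 : 1 <= C by rewrite mulr_ege1// ?exprn_ege1//; lra.
have C0 : 0 < C by lra.
pose g x := \sum_(1 <= j < (N x).+1) gamma j x.
pose W x := - ln (w x) / 2.
(* The error bound is claimed at every [x], but [W] is controlled only almost everywhere. On the
   exceptional set [Q] falls back to [g], where it suffices that the error bound is nonnegative;
   this holds as [C >= 1] and [delta <= 1]. *)
pose Q x := if `[< 0 < w x /\ (`|W x - g x|%:E <= error_bound C a (N x))%E >] then W x else g x.
exists C, Q; split => //; last first.
  move=> x x2; rewrite /Q; case: asboolP => [[]//|_].
  rewrite -/(g x) subrr normr0 /error_bound; case: eqVneq => [_|neq]; first by rewrite leey.
  rewrite lee_fin ln_ge0//.
  have d0 : 0 < a (N x).+2 - a (N x).+1 by rewrite subr_gt0 lt_neqAle a_nd eq_sym neq.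
  have d1 : a (N x).+2 - a (N x).+1 <= 1 by have := a_le1 (N x).+1; have := a_gt0 (N x); lra.
  rewrite ler_pdivlMr// mul1r; apply: le_trans d1 _.
  by rewrite mulr_ege1// ler1n leq_maxr.
have AE := ae_filter_ringOfSetsType (@lebesgue_measure R).
(* The index used below depends on [x] through [N x], so the exceptional sets of all [m] are
   discarded at once. *)
apply: (@filterS2 _ _ AE _ _ _ _ (ae_foralln upper) (ae_foralln lower)).
move=> x up lo x2; have [hN1 hN2] := hN x x2.
have xN m : (N x <= m)%N -> `|x| < 2 * a m.+1 by move=> Nm; apply: hN2.
have x_lt2 : `|x| < 2 by rewrite ltr_norml.
have rho0 : 0 < rho x.
  rewrite sqrtr_gt0; have : `|x| ^+ 2 < 2 ^+ 2 by rewrite ltrXn2r// nnegrE.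
  by rewrite real_normK ?num_real//; lra.
(* The lower bound at [m = N x] has a strictly positive left side because [|x| < 2 a_{N+1}]. This
   covers the case [a_{N+2} = a_{N+1}] as well. *)
have w_gt0 : 0 < w x.
  rewrite lt_neqAle w0 andbT eq_sym; apply/eqP => wx0.
  have := lo (N x) (xN _ (leqnn _)); rewrite wx0 mulr0 leNgt => /negP; apply.
  rewrite mulr_gt0 ?invr_gt0 ?pi_gt0// mulr_gt0//.
  have : `|x| ^+ 2 < (2 * a (N x).+1) ^+ 2.
    by rewrite ltrXn2r// ?nnegrE ?mulr_ge0//; exact: xN.
  by rewrite real_normK ?num_real//; lra.
suff QW : Q x = W x.
  by rewrite QW /W (_ : -2 * (- ln (w x) / 2) = ln (w x)) ?lnK ?posrE//; field.
rewrite /Q; case: asboolP => // -[]; split=> //.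
rewrite /error_bound; case: eqVneq => [_|neq]; first by rewrite leey.
have d0 : 0 < a (N x).+2 - a (N x).+1 by rewrite subr_gt0 lt_neqAle a_nd eq_sym neq.
have N1 : 0 < (maxn (N x) 1)%:R :> R by rewrite ltr0n leq_max orbT.
pose P := \prod_(1 <= j < (N x).+1) expR (gamma j x).
have P0 : 0 < P by rewrite /P -expR_sum expR_gt0.
have gP : g x = ln P by rewrite /P -expR_sum expRK.
rewrite lee_fin gP; apply: log_bounds => //; first by rewrite !mulr_gt0// invr_gt0.
pose s : R := if 0 <= x then 1 else -1.
have s2 : s ^+ 2 = 1 by rewrite /s; case: ifP => _; rewrite ?sqrrN expr1n.
have sx : `|x| = s * x.
  rewrite /s; case: (leP 0 x) => x0; first by rewrite ger0_norm// mul1r.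
  by rewrite ltr0_norm// mulN1r.
have Ts : turan a `|x| (fun n => s ^+ n * u x n) (N x).+1 = T (N x).+1 x.
  by rewrite sx turan_alternating.
have sq : `|x| ^+ 2 = x ^+ 2 by rewrite real_normK ?num_real.
(* With [lam j = e^{gamma_j}], the definition of [gamma] is exactly the relation
   [|x| = a_j (lam j + 1 / lam j)]. *)
apply: (@weight_bounds R a `|x| (fun n => s ^+ n * u x n) (fun j => expR (gamma j x)) (N x)
  a_gt0 a_nd a_le1 (normr_ge0 x) x_lt2) => //.
- exact: xN.
- by move=> n; rewrite sx; exact: alternating_rec.
- by rewrite expr0 mul1r /u p0 hornerC.
- rewrite sx expr1 mulrCA /u; congr (s * _).
  by have := congr1 (horner^~ x) p1; rewrite /= hornerX hornerZ.
- move=> n nN; have [g0 _] := hgamma x x2 n.+1 nN.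
  by rewrite -expR0 ler_expR.
- move=> n nN; have [_ E] := hgamma x x2 n.+1 nN.
  have -> : `|x| = a n.+1 * (`|x| / a n.+1) by rewrite mulrC divfK// gt_eqF.
  by rewrite E /cosh expRN; congr (_ * _); field; rewrite ?gt_eqF ?expR_gt0.
- by rewrite Ts sq; apply: up; exact: xN.
- by rewrite Ts sq; apply: lo; exact: xN.
Qed.
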